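(* Let $G$ be a right-orderable group and $T$ a $G$-tree with trivial edge stabilisers and finitely many $G$-orbits of edges. Fix an order on $ET$ constructed as described in the context. Let $H$ be a subgroup of $G$. Then the reduced Kurosh rank $\overline{\kappa}_T(H)$ is equal to $|E\mathcal{T}_H/H|$, the number of $H$-orbits of edges in the Dicks $H$-tree $\mathcal{T}_H$ (as elements of $\mathbb{N}\cup\{\infty\}$).
   Context: A group $G$ is right-orderable if it admits a total order invariant under right multiplication. Groups act on trees on the right, by graph automorphisms and without edge inversions; a $G$-tree is a (nonempty) tree with such an action; $VT$, $ET$ are its vertex and edge sets. Kurosh rank: for $H\leqslant G$, $c_T(H)\in\mathbb{N}\cup\{\infty\}$ is the number of $H$-orbits of vertices of $T$ with non-trivial $H$-stabiliser, $\mathrm{rank}(T/H)\in\mathbb{N}\cup\{\infty\}$ is the number of edges of $T/H$ outside a maximal subtree, $\kappa_T(H)=c_T(H)+\mathrm{rank}(T/H)$ and $\overline{\kappa}_T(H)=\max\{0,\kappa_T(H)-1\}$. Order on edges: fix a right-invariant total order $<$ on $G$, any total order $<$ on the finite set $ET/G$, and a representative of each $G$-orbit of edges. Since edge stabilisers are trivial, every edge is uniquely of the form $eg$ with $e$ a chosen representative and $g\in G$; this identifies $ET$ with $(ET/G)\times G$, which is ordered lexicographically: $eg\leq fh$ iff $eG<fG$, or $eG=fG$ and $g\leq h$. This is a $G$-invariant total order on $ET$. Minimal subtree: an element of $G$ is elliptic if it fixes a point of $T$ and hyperbolic otherwise; the axis $A_g$ of a hyperbolic $g$ is the line of points displaced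 minimally by $g$. For a non-trivial subgroup $H\leqslant G$, $T_H$ is the minimal $H$-invariant subtree: the union of the axes of the hyperbolic elements of $H$ if there are any, and otherwise the unique vertex fixed by $H$. Bridges and islands: for a subtree $T'$ of $T$, an edge $e$ of $T'$ is a $T'$-bridge if there is a reduced (backtracking-free) bi-infinite path in $T'$ containing $e$ in which $e$ is the $<$-largest edge. An $H$-bridge is a $T_H$-bridge. An $H$-island is a connected component of $T_H$ after all (open) $H$-bridges have been removed. The Dicks $H$-tree $\mathcal{T}_H$ is the $H$-tree whose vertices are the $H$-islands and whose edges are the $H$-bridges (each joining the islands containing its endpoints). For $H$ trivial, $T_H$ is taken to be a single vertex, so $\mathcal{T}_H$ has no edges. *)

(* Defs.v *)
From HB Require Import structures.
From mathcomp Require Import all_boot all_order all_algebra.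
From mathcomp Require Import boolp classical_sets functions cardinality.

Set Implicit Arguments.
Unset Strict Implicit.
Unset Printing Implicit Defensive.

Local Open Scope classical_set_scope.
Local Open Scope group_scope.

(** ** Elements of N ∪ {∞} *)

(* [None] is ∞. *)
Definition enat := option nat.

Definition ecard (X : Type) (A : set X) : enat :=
  if pselect (finite_set A) is left Afin then Some (projT1 (cid Afin))
  else None.

Definition eadd (a b : enat) : enat :=
  if (a, b) is (Some m, Some n) then Some (m + n)%N else None.

(* a |-> max {0, a - 1} *)
Definition epred (a : enat) : enat := omap predn a.

(** ** Graphs *)

(* Undirected graphs, loops and multiple edges allowed; an edge [e] is a loop
   when [ends e] is a singleton. *)
Record graph := Graph {
  vertex : Type;
  edge : Type;
  ends : edge -> set vertex;
  endsP : forall e, exists u v, ends e = [set u; v] }.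

Record subgraph (T : graph) := Subgraph {
  vset : set (vertex T);
  eset : set (edge T);
  eset_ends : forall e, eset e -> ends e `<=` vset }.

Definition subgraph_le (T : graph) (S S' : subgraph T) : Prop :=
  vset S `<=` vset S' /\ eset S `<=` eset S'.

Definition full_subgraph (T : graph) : subgraph T :=
  @Subgraph T setT setT (fun _ _ _ _ => I).

(* The sequence [:: (e1, v1); ...; (en, vn)] stands, relative to a starting
   vertex u, for the path u, e1, v1, ..., en, vn. *)
Section Paths.
Variable T : graph.
Implicit Types (u v : vertex T) (p : seq (edge T * vertex T)).

Fixpoint is_path (F : set (edge T)) u p : Prop :=
  if p is (e, v) :: q then [/\ F e, ends e = [set u; v] & is_path F v q]
  else True.

Fixpoint reduced p : Prop :=
  if p is (e, _) :: q then
    (if q is (f, _) :: _ then e <> f else True) /\ reduced q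
  else True.

Definition path_end u p : vertex T := last u (unzip2 p).

Definition joined (F : set (edge T)) u v : Prop :=
  exists2 p, is_path F u p & path_end u p = v.

(* Traversing a loop is a nonempty reduced closed path, so trees have none. *)
Definition is_tree (S : subgraph T) : Prop :=
  [/\ exists v, vset S v,
      forall u v, vset S u -> vset S v -> joined (eset S) u v &
      forall u p, vset S u -> is_path (eset S) u p -> reduced p ->
        path_end u p = u -> p = [::]].

Definition maximal_subtree (S : subgraph T) : Prop :=
  is_tree S /\
  forall S', is_tree S' -> subgraph_le S S' -> subgraph_le S' S.

Definition is_dist u v (n : nat) : Prop :=
  (exists p, [/\ is_path setT u p, path_end u p = v & size p = n]) /\
  (forall p, is_path setT u p -> path_end u p = v -> (n <= size p)%N).

Definition dist u v : nat := xget 0%N [set n | is_dist u v n].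

(* A bi-infinite reduced path.  Since consecutive vertices are the ends of the
   edge between them, this is only meaningful in loop-free graphs. *)
Definition reduced_line (F : set (edge T))
    (vs : int -> vertex T) (es : int -> edge T) : Prop :=
  forall i : int,
    [/\ F (es i), ends (es i) = [set vs i; vs (i + 1)%R] &
        es i <> es (i + 1)%R].

End Paths.

(* The number of edges outside a maximal subtree; it does not depend on which
   maximal subtree is picked when the graph is connected. *)
Definition rank (T : graph) : enat :=
  if pselect (exists S : subgraph T, maximal_subtree S) is left exS
  then ecard (~` eset (projT1 (cid exS))) else None.

(** ** Groups acting on trees *)

Definition total_order (X : Type) (le : rel X) : Prop :=
  [/\ reflexive le, antisymmetric le, transitive le & total le].

Definition right_invariant (G : groupType) (le : rel G) : Prop :=
  forall x y z : G, le x y -> le (x * z) (y * z).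

Record gtree (G : groupType) := GTree {
  gtree_graph :> graph;
  gtree_tree : is_tree (full_subgraph gtree_graph);
  vact : vertex gtree_graph -> G -> vertex gtree_graph;
  eact : edge gtree_graph -> G -> edge gtree_graph;
  vact1 : forall v, vact v 1 = v;
  vactM : forall v g h, vact v (g * h) = vact (vact v g) h;
  eact1 : forall e, eact e 1 = e;
  eactM : forall e g h, eact e (g * h) = eact (eact e g) h;
  ends_eact : forall e g, ends (eact e g) = vact^~ g @` ends e;
  no_inversion : forall e g v, eact e g = e -> ends e v -> vact v g = v }.

Section GTree.
Variables (G : groupType) (T : gtree G).
Implicit Types (v : vertex T) (e : edge T) (g : G) (H : {pred G}).

Definition trivial_edge_stabilisers : Prop :=
  forall e g, eact e g = e -> g = 1.

Definition vorbit H v : set (vertex T) :=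
  [set w | exists2 h, h \in H & w = vact v h].

Definition eorbit H e : set (edge T) :=
  [set f | exists2 h, h \in H & f = eact e h].

Definition vorbits H : set (set (vertex T)) := range (vorbit H).
Definition eorbits H : set (set (edge T)) := range (eorbit H).

(** The quotient graph T/H, for a subgroup H *)
Section Quotient.
Variables (H : {pred G}) (grpH : group_closed H).

Definition quotient_ends (O : set_type (eorbits H)) :
    set (set_type (vorbits H)) :=
  [set P | exists e v, [/\ val O e, ends e v & val P = vorbit H v]].

Lemma quotient_endsP O : exists P Q, quotient_ends O = [set P; Q].
Proof.
have H1 := grpH.1; have HV := group_closedV grpH; have HM := group_closedM grpH.
have orbE v h : h \in H -> vorbit H (vact v h) = vorbit H v.
  move=> Hh; apply/seteqP; split=> w [k Hk ->].
    by exists (h * k); [exact: HM | rewrite vactM].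
  by exists (h^-1 * k); [exact: HM (HV _ Hh) Hk | rewrite -vactM mulgA mulgV mul1g].
have mkorb v : exists P : set_type (vorbits H), val P = vorbit H v.
  have Pv : vorbit H v \in vorbits H by rewrite inE; exists v.
  by exists (SigSub Pv).
have [e _ Oe] : eorbits H (val O) by have := valP O; rewrite inE.
have [u [v uv]] := endsP e.
have [P Pu] := mkorb u; have [Q Qv] := mkorb v.
exists P, Q; apply/seteqP; split=> X; rewrite /quotient_ends /= -Oe.
  move=> -[f [w [[h Hh ->]]]]; rewrite ends_eact uv.
  by move=> [x [->|->] <-]; rewrite orbE // => XE;
    [left|right]; apply: val_inj; [exact: etrans XE (esym Pu)|exact: etrans XE (esym Qv)].
have ee : eorbit H e e by exists 1; rewrite ?eact1.
by move=> [->|->]; [exists e, u|exists e, v]; split=> //; rewrite uv;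
  [left|right].
Qed.

Definition quotient_graph : graph := Graph quotient_endsP.

End Quotient.

(** Kurosh rank *)

Definition nontrivial_stabiliser H v : Prop :=
  exists h, [/\ h \in H, h <> 1 & vact v h = v].

Definition num_nontrivial_orbits H : enat :=
  ecard (vorbit H @` [set v | nontrivial_stabiliser H v]).

Definition kurosh_rank H (grpH : group_closed H) : enat :=
  eadd (num_nontrivial_orbits H) (rank (quotient_graph grpH)).

Definition reduced_kurosh_rank H (grpH : group_closed H) : enat :=
  epred (kurosh_rank grpH).

(** The order on the edges of T *)

Lemma group_closed_predT : group_closed (predT : {pred G}).
Proof. by []. Qed.

Definition quotient_by_G : graph := quotient_graph group_closed_predT.

(* A choice of one edge in each G-orbit of edges. *)
Definition representatives (rep : edge quotient_by_G -> edge T) : Prop :=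
  forall O, val O (rep O).

Definition edge_le (leG : rel G) (leO : rel (edge quotient_by_G))
    (rep : edge quotient_by_G -> edge T) (e f : edge T) : Prop :=
  exists O g P h,
    [/\ e = eact (rep O) g, f = eact (rep P) h &
        (O <> P /\ leO O P) \/ (O = P /\ leG g h)].

(** Minimal subtrees *)

(* Edges are never inverted, so an element fixing an interior point of an edge
   also fixes the ends of this edge. *)
Definition elliptic g : Prop := exists v : vertex T, vact v g = v.
Definition hyperbolic g : Prop := ~ elliptic g.

Definition min_displaced g : set (vertex T) :=
  [set v | forall w : vertex T, (dist v (vact v g) <= dist w (vact w g))%N].

(* For g hyperbolic the points displaced minimally form a line, so that an edge
   consists of such points as soon as its ends do. *)
Definition axis g : subgraph T :=
  @Subgraph T (min_displaced g) [set e | ends e `<=` min_displaced g]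
    (fun _ s => s).

Definition hyperbolics H : set G := [set h | h \in H /\ hyperbolic h].

Definition axes_union H : subgraph T.
refine (@Subgraph T (\bigcup_(h in hyperbolics H) vset (axis h))
                    (\bigcup_(h in hyperbolics H) eset (axis h)) _).
by move=> e [h Hh he] v /he hv; exists h.
Defined.

Definition edgeless_subgraph (A : set (vertex T)) : subgraph T :=
  @Subgraph T A set0 (fun _ => False_ind _).

Definition fixed_vertices H : set (vertex T) :=
  [set v : vertex T | forall h, h \in H -> vact v h = v].

(* An arbitrarily chosen singleton. *)
Definition some_vertex : set (vertex T) :=
  xget set0 (range (@set1 (vertex T))).

Definition minimal_subtree H : subgraph T :=
  if pselect (hyperbolics H !=set0) then axes_union H
  else if pselect (forall h, h \in H -> h = 1)
  then edgeless_subgraph some_vertex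
  else edgeless_subgraph (fixed_vertices H).

(** Bridges, islands and the Dicks tree; [le] is the order on the edges *)
Section Dicks.
Variable le : edge T -> edge T -> Prop.

Definition is_bridge (S : subgraph T) e : Prop :=
  exists vs es,
    [/\ reduced_line (eset S) vs es, exists i, es i = e &
        forall j, le (es j) e].

Definition bridges H : set (edge T) :=
  [set e | eset (minimal_subtree H) e /\ is_bridge (minimal_subtree H) e].

(* An island is given by its set of vertices. *)
Definition island_of H v : set (vertex T) :=
  [set w | joined (eset (minimal_subtree H) `\` bridges H) v w].

Definition islands H : set (set (vertex T)) :=
  island_of H @` vset (minimal_subtree H).

Definition dicks_ends H (e : set_type (bridges H)) :
    set (set_type (islands H)) :=
  [set X | exists2 v, ends (val e) v & val X = island_of H v].

Lemma dicks_endsP H (e : set_type (bridges H)) :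
  exists X Y, dicks_ends e = [set X; Y].
Proof.
have [eS _] : bridges H (val e) by have := valP e; rewrite inE.
have mkisl v : ends (val e) v ->
    exists X : set_type (islands H), val X = island_of H v.
  move=> ev; have Xv : island_of H v \in islands H.
    by rewrite inE; exists v => //; exact: eset_ends eS _ ev.
  by exists (SigSub Xv).
have [u [v uv]] := endsP (val e).
have [|X Xu] := mkisl u; first by rewrite uv; left.
have [|Y Yv] := mkisl v; first by rewrite uv; right.
exists X, Y; apply/seteqP; split=> Z /=.
  by rewrite /dicks_ends /= uv => -[x [->|->] ZE]; [left|right];
    apply: val_inj; [exact: etrans ZE (esym Xu)|exact: etrans ZE (esym Yv)].
by rewrite /dicks_ends /= uv => -[->|->]; [exists u; [left|]|exists v; [right|]].
Qed.

Definition dicks_tree H : graph := Graph (@dicks_endsP H).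

(* H acts on the Dicks tree through its action on T. *)
Definition dicks_eorbit H (e : edge (dicks_tree H)) :
    set (edge (dicks_tree H)) :=
  [set f | exists2 h, h \in H & val f = eact (val e) h].

Definition num_dicks_eorbits H : enat := ecard (range (@dicks_eorbit H)).

End Dicks.

End GTree.

(* Main.v *)
(* Let X be a finite connected subgraph of T/H and P its preimage in T; call an
   edge of P a P-bridge if it is the largest edge of some reduced line in P.
   For e in P, look at the components of {f in P | f < e} containing the ends
   of e. If each of them is infinite or has a vertex v with non-trivial
   stabiliser, then e is a P-bridge: a descending ray leaves e on both sides,
   by Koenig's lemma in the first case and, in the second one, by going to v and
   back to the translate el < e for some l in H_v. Otherwise e is not a P-bridge.
   Run Kruskal's algorithm, rooting every finite component with trivial
   stabilisers at its smallest vertex for some H-invariant order. Then each edge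
   of P that is not a P-bridge kills exactly one root, and modulo H this is an
   injection from these edges to the vertices of P with trivial stabiliser,
   surjective as soon as there is a P-bridge. Hence the number of H-orbits of
   P-bridges is r + c - 1 (or 0 if r + c = 0), where r counts the edges of X
   outside a maximal subtree and c its vertices with non-trivial stabiliser.
   By the pigeonhole principle, a reduced line in P lies in a union of axes, so
   that P-bridges are H-bridges. If the Kurosh rank is finite, X can be taken to
   contain all that it counts; then P contains T_H, and the two kinds of bridges
   agree. If it is infinite, X gives arbitrarily many bridges. *)

Require Import Defs.
From HB Require Import structures.
From mathcomp Require Import all_boot all_order all_algebra.
From mathcomp Require Import boolp classical_sets functions cardinality.
From mathcomp Require Import finmap zify.
From mathcomp Require wochoice.

Set Implicit Arguments.
Unset Strict Implicit.
Unset Printing Implicit Defensive.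

Local Open Scope classical_set_scope.
Local Open Scope group_scope.

(** * Cardinalities *)

Lemma dependent_choice X (Q : X -> Prop) (R : X -> X -> Prop) (x0 : X) :
  (forall x, Q x -> exists2 y, Q y & R x y) -> Q x0 ->
  exists f : nat -> X, f 0%N = x0 /\ forall n, Q (f n) /\ R (f n) (f n.+1).
Proof.
move=> QR Q0.
have /choice[g gP] : forall x : {x | Q x}, exists y : {x | Q x},
    R (proj1_sig x) (proj1_sig y).
  by move=> [x Qx]; have [y Qy Rxy] := QR x Qx; exists (exist _ y Qy).
exists (fun n => proj1_sig (iter n g (exist _ x0 Q0))); split=> // n; split.
  exact: proj2_sig.
by rewrite iterS; exact: gP.
Qed.

Section Cardinality.
Local Open Scope card_scope.

(** Correspondences between orbits are given below through representatives; a relation spares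
    defining a map on the orbits. *)
Lemma card_le_rel X Y (A : set X) (B : set Y) (R : X -> Y -> Prop) :
  (forall a, A a -> exists2 b, B b & R a b) ->
  (forall a a' b, A a -> A a' -> R a b -> R a' b -> a = a') ->
  A #<= B.
Proof.
(* [Y] may be empty, so [option] supplies the value [None] outside [A]. *)
move=> AB inj; rewrite -(@card_le_some _ {classic Y}).
apply/pcard_leP/injfunPex.
have /choice[f fP] : forall a, exists y : option {classic Y},
    A a -> exists2 b, B b /\ R a b & y = Some b.
  move=> a; have [/AB[b Bb Rab]|nA] := pselect (A a); last by exists None.
  by exists (Some b) => _; exists b.
exists f => [a /fP[b [Bb _] ->]|a a']; first by exists b.
move=> /set_mem Aa /set_mem Aa'; have [b [_ Rab] ->] := fP a Aa.
by have [b' [_ Rab'] ->] := fP a' Aa' => -[bb']; subst b'; exact: inj Rab'.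
Qed.

Lemma card_eq_rel X Y (A : set X) (B : set Y) (R : X -> Y -> Prop) :
  (forall a, A a -> exists2 b, B b & R a b) ->
  (forall b, B b -> exists2 a, A a & R a b) ->
  (forall a a' b, A a -> A a' -> R a b -> R a' b -> a = a') ->
  (forall a b b', B b -> B b' -> R a b -> R a b' -> b = b') ->
  A #= B.
Proof.
move=> AB BA injA injB; rewrite card_eq_le; apply/andP; split.
  exact: (card_le_rel (R := R)).
apply: (card_le_rel (R := fun b a => R a b)) => // b b' a Bb Bb'.
exact: injB.
Qed.

Lemma card_II_uniq X (A : set X) m n : A #= `I_m -> A #= `I_n -> m = n.
Proof.
move=> Am An; apply/card_eq_II.
by apply: card_eq_trans An; rewrite card_eq_sym.
Qed.

Lemma card_II_le X Y (A : set X) (B : set Y) m n :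
  A #= `I_m -> B #= `I_n -> A #<= B -> (m <= n)%N.
Proof.
by move=> Am Bn; rewrite (card_le_eql Am) (card_le_eqr Bn) card_le_II.
Qed.

Lemma card_setU_disj X (A B : set X) m n :
  A `&` B = set0 -> A #= `I_m -> B #= `I_n -> A `|` B #= `I_(m + n).
Proof.
move=> AB0.
have key (a b : set {classic X}) : a `&` b = set0 ->
    a #= `I_m -> b #= `I_n -> a `|` b #= `I_(m + n).
  move=> ab0 am bn.
  have fa : finite_set a by apply/finite_setP; exists m.
  have fb : finite_set b by apply/finite_setP; exists n.
  have fab : finite_set (a `|` b) by rewrite finite_setU.
  rewrite -[_ `|` _]fset_setK//; apply/card_eq_fsetP.
  rewrite fset_setU// -(card_fset_set am) -(card_fset_set bn) -cardfsUI.
  by rewrite -fset_setI// ab0 fset_set0 cardfs0 addn0.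
exact: key.
Qed.

Lemma infinite_subset X (A : set X) n : infinite_set A ->
  exists2 B : set X, B `<=` A & B #= `I_n.
Proof.
move=> /infiniteP Ainf.
have : `I_n #<= A by apply: card_le_trans Ainf; exact: card_leT.
rewrite -(@card_le_some _ {classic X}) => /pcard_leP/injfunPex[f fA finj].
exists [set a | exists2 i, (i < n)%N & f i = Some a] => [a [i ltin fi]|].
  by have [b Ab fb] := fA i ltin; move: fi; rewrite -fb => -[<-].
apply: (card_eq_rel (R := fun a i => f i = Some a)).
- by move=> a [i]; exists i.
- by move=> i ltin; have [b Ab fb] := fA i ltin; exists b; [exists i|].
- by move=> a a' i _ _ -> [].
- by move=> a i j ltin ltjn fi fj; apply: finj; [exact: mem_set|exact: mem_set|rewrite fi fj].
Qed.

Lemma finite_min X (le : X -> X -> Prop) (A : set X) :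
  (forall x y z, le x y -> le y z -> le x z) ->
  (forall x y, le x y \/ le y x) ->
  finite_set A -> A !=set0 -> exists2 a, A a & forall b, A b -> le a b.
Proof.
move=> letr leto.
have key (A' : set {classic X}) : finite_set A' -> A' !=set0 ->
    exists2 a, A' a & forall b, A' b -> le a b.
  move=> /finite_seqP[s ->] [x xs].
  have {xs} : s != [::] by move: xs => /=; case: s.
  elim: s => // a [_ _|b s IH _]; first exists a; rewrite /= ?inE//.
    by move=> b; rewrite inE => /eqP ->; case: (leto a a).
  have [//|c /= cs cmin] := IH.
  have [ac|ca] := leto a c.
    exists a => /= [|d]; rewrite inE ?eqxx// => /orP[/eqP->|/cmin cd].
      by case: (leto a a).
    exact: letr cd.
  by exists c => /= [|d]; rewrite inE ?cs ?orbT// => /orP[/eqP->|/cmin].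
exact: key.
Qed.

(** The pigeonhole principle, past any given index [N]. *)
Lemma finite_image_nat X (f : nat -> X) (N : nat) : finite_set (range f) ->
  exists i j, [/\ (N <= i)%N, (i < j)%N & f i = f j].
Proof.
move=> frange; apply: contrapT => nex; apply: (@infinite_nat).
have : [set: nat] #<= range f.
  apply: (card_le_rel (R := fun i y => f (N + i)%N = y)).
    by move=> i _; exists (f (N + i)%N); [exists (N + i)%N|].
  move=> i j y _ _ fi fj; apply: contrapT => /eqP.
  rewrite neq_ltn => /orP[ij|ji]; apply: nex.
    by exists (N + i)%N, (N + j)%N; rewrite leq_addr ltn_add2l fi fj.
  by exists (N + j)%N, (N + i)%N; rewrite leq_addr ltn_add2l fi fj.
by move=> /card_le_finite; exact.
Qed.

Lemma ecardP X (A : set X) n : A #= `I_n -> ecard A = Some n.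
Proof.
move=> An; rewrite /ecard; case: pselect => [fA|[]]; last first.
  by apply/finite_setP; exists n.
by congr Some; case: cid => m Am /=; exact: card_II_uniq Am An.
Qed.

Lemma ecard_infinite X (A : set X) : infinite_set A -> ecard A = None.
Proof. by rewrite /ecard; case: pselect. Qed.

End Cardinality.

(** * Paths, trees and lines in graphs *)

Section Graph.
Variable T : graph.
Implicit Types (u v w : vertex T) (e f : edge T) (F : set (edge T)).
Implicit Types (p q : seq (edge T * vertex T)) (d : edge T * vertex T).

Lemma set2_eq X (a b c d : X) : [set a; b] = [set c; d] ->
  (a = c /\ b = d) \/ (a = d /\ b = c).
Proof.
move=> E.
have A : [set c; d] a by rewrite -E; left.
have B : [set c; d] b by rewrite -E; right.
have C : [set a; b] c by rewrite E; left.
have D : [set a; b] d by rewrite E; right.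
by case: A => /= A; case: B => /= B; case: C => /= C; case: D => /= D;
  subst; auto.
Qed.

Lemma set2_inj X (a b c : X) : [set a; b] = [set a; c] -> b = c.
Proof. by move=> E; have [[_ ->]|[<- ->]] := set2_eq E. Qed.

Lemma other_end e u : ends e u -> exists v, ends e = [set u; v].
Proof.
have [a [b E]] := endsP e; rewrite E => -[->|->]; first by exists b.
by exists a; rewrite setUC.
Qed.

Lemma is_path_cat F u p q :
  is_path F u (p ++ q) <-> is_path F u p /\ is_path F (path_end u p) q.
Proof.
elim: p u => [u|[e v] p IH u] /=; first by split=> [|[]].
rewrite /path_end /= -/(path_end v p).
split=> [[Fe uv /IH[pp qq]]|[[Fe uv pp] qq]]; first by split.
by split=> //; apply/IH.
Qed.

Lemma path_end_cat u p q : path_end u (p ++ q) = path_end (path_end u p) q.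
Proof. by rewrite /path_end /unzip2 map_cat last_cat. Qed.

Lemma path_end_rcons u p d : path_end u (rcons p d) = d.2.
Proof. by rewrite -cats1 path_end_cat. Qed.

Lemma path_end_cons u p d : path_end u (d :: p) = path_end d.2 p.
Proof. by []. Qed.

Lemma is_path_sub F F' u p : F `<=` F' -> is_path F u p -> is_path F' u p.
Proof.
by move=> FF'; elim: p u => // -[e v] p IH u /= [/FF' ? ? /IH].
Qed.

(** Each edge of a path is paired with its far end, so running [p] backwards shifts the vertices by
    one and needs the start [u]. *)
Fixpoint reversal u p : seq (edge T * vertex T) :=
  if p is (e, v) :: q then rcons (reversal v q) (e, u) else [::].

Lemma is_path_rev F u p : is_path F u p ->
  is_path F (path_end u p) (reversal u p).
Proof.
elim: p u => // -[e v] p IH u /= [Fe uv /IH pp].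
rewrite -cats1; apply/is_path_cat; rewrite path_end_cons; split=> //=.
split=> //; rewrite uv setUC; congr [set _; _].
by case: p {IH pp} => [|[f w] q] //=; rewrite path_end_rcons.
Qed.

Lemma path_end_rev u p : path_end (path_end u p) (reversal u p) = u.
Proof. by case: p => [|[e v] p] //=; rewrite path_end_rcons. Qed.

Lemma size_reversal u p : size (reversal u p) = size p.
Proof. by elim: p u => // -[e v] p IH u /=; rewrite size_rcons IH. Qed.

Lemma reversal_cat u p q :
  reversal u (p ++ q) = reversal (path_end u p) q ++ reversal u p.
Proof.
elim: p u => [|[e v] p IH] u /=; first by rewrite cats0.
by rewrite IH rcons_cat.
Qed.

Lemma reducedP p :
  reduced p <-> forall p1 d d' p2, p = p1 ++ d :: d' :: p2 -> d.1 <> d'.1.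
Proof.
elim: p => [|[e v] p IH] /=; first by split=> // _ [].
split=> [[ep /IH rp] [|d' p1] d f p2 /= [E Ep]|rp].
- by move: ep; rewrite Ep -E; case: f {Ep}.
- exact: rp Ep.
split; last by apply/IH => p1 d d' p2 E; apply: (rp ((e, v) :: p1)); rewrite E.
by case: p rp {IH} => // -[f w] p /(_ [::] (e, v) (f, w) p erefl).
Qed.

Lemma reduced_catl p q : reduced (p ++ q) -> reduced p.
Proof.
move=> /reducedP r; apply/reducedP => p1 d d' p2 E.
by apply: (r p1 d d' (p2 ++ q)); rewrite E -catA.
Qed.

Lemma reduced_catr p q : reduced (p ++ q) -> reduced q.
Proof.
move=> /reducedP r; apply/reducedP => p1 d d' p2 E.
by apply: (r (p ++ p1) d d' p2); rewrite E catA.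
Qed.

Lemma reduced_glue p d q : reduced (rcons p d) -> reduced (d :: q) ->
  reduced (p ++ d :: q).
Proof.
elim: p => [|[e v] p IH] //= [ep rp] rq; split; last exact: IH.
by case: p ep {IH rp} => [|[f w] p] //=; case: d {rq}.
Qed.

Lemma reduced_junction p d d' q : reduced (rcons p d) -> reduced (d' :: q) ->
  d.1 <> d'.1 -> reduced (rcons p d ++ d' :: q).
Proof.
move=> rp rq dd'; rewrite cat_rcons; apply: reduced_glue => //.
by case: d d' dd' rp rq => [e v] [f w].
Qed.

Lemma reduced_rev u p : reduced p -> reduced (reversal u p).
Proof.
elim: p u => // -[e v] p IH u /=; case: p IH => // -[f w] p IH [ef rp].
have rr := IH v rp; rewrite -[rcons _ (e, u)]cats1.
by apply: reduced_junction => //= /esym.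
Qed.

Lemma joined_refl F u : joined F u u.
Proof. by exists [::]. Qed.

Lemma joined_sym F u v : joined F u v -> joined F v u.
Proof.
move=> [p pp <-]; exists (reversal u p); first exact: is_path_rev.
exact: path_end_rev.
Qed.

Lemma joined_trans F u v w : joined F u v -> joined F v w -> joined F u w.
Proof.
move=> [p pp pv] [q qq qw]; exists (p ++ q).
  by apply/is_path_cat; rewrite pv.
by rewrite path_end_cat pv.
Qed.

Lemma joined_sub F F' u v : F `<=` F' -> joined F u v -> joined F' u v.
Proof. by move=> FF' [p pp pv]; exists p => //; exact: is_path_sub pp. Qed.

Lemma joined_edge F e u v : F e -> ends e = [set u; v] -> joined F u v.
Proof. by move=> Fe uv; exists [:: (e, v)]. Qed.

Lemma joined_closed F (D : set (vertex T)) u v :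
  (forall e x y, F e -> ends e = [set x; y] -> D x -> D y) ->
  D u -> joined F u v -> D v.
Proof.
move=> DF Du [p pp <-]; elim: p u Du pp => // -[e w] p IH u Du /= [Fe uw].
by apply: IH; exact: DF Fe uw Du.
Qed.

Lemma reduce_path F u p : is_path F u p ->
  exists q, [/\ is_path F u q, path_end u q = path_end u p,
                reduced q & (size q <= size p)%N].
Proof.
elim: p u => [|[e v] p IH] u; first by exists [::].
move=> /= [Fe uv /IH[q [qq qp rq sq]]].
case: q qq qp rq sq => [|[f w] q] qq qp rq sq.
  by exists [:: (e, v)].
have [ef|ef] := pselect (e = f); last first.
  by exists ((e, v) :: (f, w) :: q); split.
subst f; move: qq => /= [_ vw qq]; exists q.
have wu : w = u by apply: (@set2_inj _ v); rewrite -vw uv setUC.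
subst w; split=> //; last by apply: leqW; apply: ltnW.
by case: rq.
Qed.

Lemma joined_reduced F u v : joined F u v ->
  exists p, [/\ is_path F u p, path_end u p = v & reduced p].
Proof.
by move=> [p /reduce_path[q [qq qp rq _]] <-]; exists q.
Qed.

(** * Acyclic sets of edges *)

Definition acyclic F := forall u p,
  is_path F u p -> reduced p -> path_end u p = u -> p = [::].

Lemma acyclic_sub F F' : F `<=` F' -> acyclic F' -> acyclic F.
Proof. by move=> FF' ac u p /(is_path_sub FF'); exact: ac. Qed.

(** Strip equal first edges. Where they differ, one path run backwards followed by the other is
    reduced and closed, yet nonempty. *)
Lemma acyclic_uniq F u p q : acyclic F -> is_path F u p -> is_path F u q ->
  reduced p -> reduced q -> path_end u p = path_end u q -> p = q.
Proof.
move=> ac; elim: p u q => [|[e v] p IH] u [|[f w] q] //.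
- by move=> _ qq _ rq E; rewrite (ac u _ qq rq).
- by move=> pp _ rp _ E; rewrite (ac u _ pp rp).
move=> pp qq rp rq E.
have [ef|ef] := pselect (e = f).
  subst f; move: pp qq => /= [Fe uv pp] [_ uw qq].
  have vw : v = w by apply: (@set2_inj _ u); rewrite -uv uw.
  subst w; congr (_ :: _); apply: (IH v) => //.
    by move: rp => /= [].
  by move: rq => /= [].
suff : reversal u ((e, v) :: p) ++ (f, w) :: q = [::].
  by move/(congr1 size); rewrite size_cat addnS.
apply: (ac (path_end u ((e, v) :: p))).
- apply/is_path_cat; split; first exact: is_path_rev pp.
  by rewrite path_end_rev.
- by apply: reduced_junction => //; exact: (reduced_rev u rp).
- by rewrite path_end_cat path_end_rev E.
Qed.

Lemma acyclic_no_loop F e u : acyclic F -> F e -> ends e <> [set u; u].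
Proof.
move=> ac Fe uu; suff : [:: (e, u)] = [::] by [].
exact: (ac u).
Qed.

(** A reduced path in [F] between the ends of [e] would close up with [e] to a reduced closed path
    in [F'], as it does not use [e]. *)
Lemma acyclic_sep F F' e u w : acyclic F' -> F `<=` F' -> F' e -> ~ F e ->
  ends e = [set u; w] -> ~ joined F u w.
Proof.
move=> ac FF' F'e nFe uw /joined_reduced[p [pp pw rp]].
suff : (e, u) :: p = [::] by []; apply: (ac w) => //.
- by split; [|rewrite uw setUC|exact: is_path_sub pp].
- split=> //=; case: p pp {pw rp} => // -[f v] p [Ff _ _] ef.
  by apply: nFe; rewrite ef.
Qed.

(* A reduced path entering a component through [e], which joins it to another
   one, never crosses [e] again. *)
Lemma acyclic_add F e u w : acyclic F -> ends e = [set u; w] ->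
  ~ joined F u w -> acyclic (e |` F).
Proof.
move=> ac uw nj.
have first_e x p : is_path (e |` F) x p ->
    is_path F x p \/ exists p1 z p2, [/\ p = p1 ++ (e, z) :: p2,
      is_path F x p1 & ends e = [set path_end x p1; z]].
  elim: p x => [|[f v] p IH] x /=; first by left.
  move=> [Ff xv pp].
  have [fe|fe] := pselect (f = e).
    by subst f; right; exists [::], v, p.
  have {}Ff : F f by case: Ff.
  case: (IH v pp) => [pF|[p1 [z [p2 [-> pF E]]]]]; first by left; split.
  by right; exists ((f, v) :: p1), z, p2; split.
have noagain a b q : ends e = [set a; b] -> ~ joined F a b ->
    is_path (e |` F) b q -> reduced ((e, b) :: q) -> is_path F b q.
  move=> ab nab qq rq.
  case: (first_e b q qq) => // -[p1 [z [p2 [E pF ez]]]]; exfalso.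
  have : ends e (path_end b p1) by rewrite ez; left.
  rewrite ab => -[pa|pb].
    by apply: nab; apply: joined_sym; exists p1.
  have p10 : p1 = [::].
    apply: (ac b) => //; apply: (@reduced_catl _ ((e, z) :: p2)).
    by rewrite -E; apply: (@reduced_catr [:: (e, b)]).
  move: rq; rewrite E p10 => /reducedP/(_ [::] (e, b) (e, z) p2 erefl).
  exact.
move=> x p pp rp px; case: (first_e x p pp) => [pF|]; first exact: ac pF rp px.
move=> [p1 [z [p2 [E pF ez]]]]; exfalso.
have nj' : ~ joined F (path_end x p1) z.
  have : [set u; w] = [set path_end x p1; z] by rewrite -uw ez.
  by move=> E'; have [[<- <-]|[<- <-]] := set2_eq E' => // /joined_sym.
have : is_path F z p2.
  apply: noagain ez nj' _ _.
    by move: pp; rewrite E => /is_path_cat[_ []].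
  by move: rp; rewrite E => /reduced_catr.
move=> p2F; apply: nj'; apply: (@joined_trans _ _ x).
  by apply: joined_sym; exists p1.
apply: joined_sym; exists p2 => //.
by move: px; rewrite E path_end_cat path_end_cons.
Qed.

Lemma is_tree_acyclic (S : subgraph T) : is_tree S -> acyclic (eset S).
Proof.
move=> [_ _ ac] u [|[e v] p] // pp; apply: ac => //.
by move: pp => /= [Se uv _]; apply: eset_ends Se _ _; rewrite uv; left.
Qed.

(** * Rays *)

Definition ray F (x : nat -> vertex T) (y : nat -> edge T) :=
  forall i, [/\ F (y i), ends (y i) = [set x i; x i.+1] & y i <> y i.+1].

Definition segment (x : nat -> vertex T) (y : nat -> edge T) i n :=
  [seq (y k, x k.+1) | k <- iota i n].

Section Segment.
Variables (F : set (edge T)) (x : nat -> vertex T) (y : nat -> edge T).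
Hypothesis r : ray F x y.

Lemma segment_cat i m n :
  segment x y i (m + n) = segment x y i m ++ segment x y (i + m) n.
Proof. by rewrite /segment iotaD map_cat. Qed.

Lemma path_end_segment i n : path_end (x i) (segment x y i n) = x (i + n)%N.
Proof.
case: n => [|n]; first by rewrite addn0.
by rewrite -addn1 segment_cat path_end_cat addn1 addnS.
Qed.

Lemma is_path_segment i n : is_path F (x i) (segment x y i n).
Proof.
by elim: n i => //= n IH i; have [? ? _] := r i; split=> //; exact: IH.
Qed.

Lemma reduced_segment i n : reduced (segment x y i n).
Proof.
elim: n i => //= n IH i; split; last exact: IH.
by case: n {IH} => //= n; have [] := r i.
Qed.

Lemma ray_inj i j : acyclic F -> (i < j)%N -> x i <> x j.
Proof.
move=> ac ij E; have := ac (x i) (segment x y i (j - i)).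
rewrite path_end_segment subnKC ?(ltnW ij)//.
move=> /(_ (is_path_segment _ _) (reduced_segment _ _) (esym E)).
by move=> /(congr1 size); rewrite size_map size_iota => /eqP; rewrite subn_eq0 leqNgt ij.
Qed.

(** A repeated edge, crossed in either direction, repeats a vertex. *)
Lemma ray_edge_inj i j : acyclic F -> (i < j)%N -> y i <> y j.
Proof.
move=> ac ij E; have [_ xi _] := r i; have [_ xj _] := r j.
have : [set x i; x i.+1] = [set x j; x j.+1] by rewrite -xi -xj E.
move=> E'; have [[xij _]|[xij _]] := set2_eq E'.
  exact: ray_inj xij.
by apply: (ray_inj (j := j.+1)) xij => //; apply: leqW.
Qed.

End Segment.

(** * Bridges as pairs of half-rays *)

Section Bridges.
Variable le : edge T -> edge T -> Prop.

Definition bridge_in F e := exists vs es,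
  [/\ reduced_line F vs es, exists i, es i = e & forall j, le (es j) e].

(** One half of a line witnessing a bridge: it starts by crossing [e] from [u] to [v], and [e] is
    its largest edge. *)
Definition halfray F e u v := exists x y,
  [/\ ray F x y, y 0%N = e, x 0%N = u, x 1%N = v & forall i, le (y i) e].

Lemma line_ray F vs es (j : int) : reduced_line F vs es ->
  ray F (fun k => vs (j + k%:Z)%R) (fun k => es (j + k%:Z)%R).
Proof.
move=> r i; have := r (j + i%:Z)%R.
by have -> : (j + i%:Z + 1 = j + i.+1%:Z)%R by lia.
Qed.

Lemma reduced_line_rev F vs es : reduced_line F vs es ->
  reduced_line F (fun j => vs (- j)%R) (fun j => es (- j - 1)%R).
Proof.
move=> r j; split.
- by have [] := r (- j - 1)%R.
- have [_ -> _] := r (- j - 1)%R; rewrite setUC.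
  have -> : (- j - 1 + 1 = - j)%R by lia.
  have -> : (- (j + 1) = - j - 1)%R by lia.
  by [].
- have [_ _] := r (- (j + 1) - 1)%R.
  have -> : (- (j + 1) - 1 + 1 = - j - 1)%R by lia.
  exact: nesym.
Qed.

Lemma line_halfray F vs es (i : int) : reduced_line F vs es ->
  (forall j, le (es j) (es i)) -> halfray F (es i) (vs i) (vs (i + 1)%R).
Proof.
move=> r imax.
exists (fun k => vs (i + k%:Z)%R), (fun k => es (i + k%:Z)%R).
by split; rewrite ?GRing.addr0//; exact: line_ray.
Qed.

Lemma bridge_halfrays F e u v : bridge_in F e -> ends e = [set u; v] ->
  halfray F e u v /\ halfray F e v u.
Proof.
move=> [vs [es [r [i ei] emax]]] uv; subst e.
have [_ E _] := r i.
have h1 := line_halfray r emax.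
have h2 : halfray F (es i) (vs (i + 1)%R) (vs i).
  have := @line_halfray F _ _ (- i - 1)%R (reduced_line_rev r).
  have -> : (- (- i - 1) - 1 = i)%R by lia.
  have -> : (- (- i - 1) = i + 1)%R by lia.
  have -> : (- (- i - 1 + 1) = i)%R by lia.
  by apply => j; exact: emax.
move: uv; rewrite E => uv.
by have [[<- <-]|[<- <-]] := set2_eq uv.
Qed.

Lemma halfrays_bridge F e u v : ends e = [set u; v] ->
  halfray F e u v -> halfray F e v u -> bridge_in F e.
Proof.
move=> uv [x [y [r y0 x0 x1 ymax]]] [x' [y' [r' y'0 x'0 x'1 y'max]]].
(* Both rays start with [e], crossed in opposite directions: [x' 1] is [x 0], so the index -1, that
   is [Negz 0], receives [x' 2] and [y' 1]. *)
exists (fun j : int => if j is Negz n then x' n.+2 else x `|j|%N).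
exists (fun j : int => if j is Negz n then y' n.+1 else y `|j|%N).
split; last first.
- by case=> n /=.
- by exists 0%R.
case=> [n|n].
  have -> : (Posz n + 1 = Posz n.+1)%R by lia.
  exact: r.
have [F1 E1 N1] := r' n.+1; have [F0 E0 N0] := r' n.
case: n => [|n] in F1 E1 N1 F0 E0 N0 *.
  have -> : (Negz 0 + 1 = Posz 0)%R by lia.
  by rewrite /= x0 y0 -x'1 -y'0 E1 setUC; split=> //; exact: nesym.
have -> : (Negz n.+1 + 1 = Negz n)%R by lia.
by rewrite E1 setUC; split=> //; exact: nesym.
Qed.

End Bridges.
End Graph.

(** * Spanning trees *)

Section SpanningTree.
Variable T : graph.
Implicit Types (u v w : vertex T) (e f : edge T) (F : set (edge T)).
Hypothesis Tconn : forall u v, joined setT u v.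

Lemma boundary_edge (D : set (vertex T)) u v : D u -> ~ D v ->
  exists e x y, [/\ ends e = [set x; y], D x & ~ D y].
Proof.
move=> Du nDv; apply: contrapT => nex; apply: nDv.
apply: (joined_closed (F := setT)) Du (Tconn u v) => e x y _ xy Dx.
by apply: contrapT => nDy; apply: nex; exists e, x, y.
Qed.

(** Zorn's lemma: a path has finitely many edges, so a nonempty one in the union of a chain lies in
    a member of the chain. *)
Lemma maximal_acyclic : exists F : set (edge T),
  acyclic F /\ forall F', F `<` F' -> ~ acyclic F'.
Proof.
apply: Zorn_bigcup => C Cac Ctot u p pp rp pu.
suff [//|[X CX Xp]] : p = [::] \/ exists2 X, C X & is_path X u p.
  exact: Cac X CX u p Xp rp pu.
elim: p u pp {rp pu} => [|[e v] p IH] u /=; first by left.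
move=> [[X CX Xe] uv /IH[->|[Y CY Yp]]]; right.
  by exists X.
have [XY|YX] := Ctot X Y CX CY.
  by exists Y => //; split=> //; exact: XY.
by exists X => //; split=> //; exact: is_path_sub Yp.
Qed.

(** A maximal acyclic set is connected, for an edge leaving a component could be added to it; with
    all vertices it forms a maximal subtree. *)
Lemma maximal_subtree_exists v : exists S : subgraph T, maximal_subtree S.
Proof.
have [F [Fac Fmax]] := maximal_acyclic.
exists (@Subgraph T setT F (fun _ _ _ _ => I)); split.
  split=> [|x y _ _|x p _] /=; [by exists v| |exact: Fac].
  apply: contrapT => nxy.
  have [e [a [b [ab xa nxb]]]] :=
    @boundary_edge (fun z => joined F x z) x y (joined_refl _ _) nxy.
  have nab : ~ joined F a b by move/(joined_trans xa).
  apply: (Fmax (e |` F)); last exact: acyclic_add ab nab.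
  split=> [f Ff|/(_ e (or_introl erefl)) Fe]; first by right.
  exact/nab/joined_edge/ab.
move=> S' /is_tree_acyclic S'ac [_ FS']; split=> //= e S'e.
apply: contrapT => nFe; apply: Fmax S'ac; split=> //.
by move=> /(_ e S'e).
Qed.

Lemma joined_vset (S : subgraph T) u v :
  vset S u -> joined (eset S) u v -> vset S v.
Proof.
apply: joined_closed => e x y Se xy _.
by apply: eset_ends Se _ _; rewrite xy; right.
Qed.

(** Otherwise an edge leaving [S] could be added together with its outer end. *)
Lemma maximal_subtree_spans (S : subgraph T) v :
  maximal_subtree S -> vset S v.
Proof.
move=> [[[u Su] Sconn Sac] Smax]; apply: contrapT => nSv.
have [e [x [y [xy Sx nSy]]]] := boundary_edge Su nSv.
pose V := y |` vset S; pose E := e |` eset S.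
have EV f : E f -> ends f `<=` V.
  case=> [->|Sf]; last by move=> z /(eset_ends Sf); right.
  by rewrite xy => z [->|->]; [right|left].
pose S' := @Subgraph T V E EV.
have S'x z : vset S' z -> joined (eset S') x z.
  case=> [->|Sz].
    by apply: joined_edge xy; left.
  by apply: joined_sub (Sconn x z Sx Sz) => f; right.
suff S't : is_tree S'.
  have [|VS _] := Smax S' S't; first by split=> z; right.
  by apply: nSy; apply: VS; left.
split; first by exists x; right.
  move=> a b S'a S'b; apply: joined_trans (S'x b S'b).
  exact/joined_sym/S'x.
move=> a p _; apply: (acyclic_add _ xy).
  exact: (is_tree_acyclic (And3 (ex_intro _ u Su) Sconn Sac)).
by move/joined_vset => /(_ Sx).
Qed.

(** The depth of [v] is the length of the reduced path from [v] to [r]; the first edge of this path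
    is the only one at [v] that decreases the depth. *)
Lemma spanning_tree_depth (S : subgraph T) r :
  is_tree S -> (forall v, vset S v) ->
  exists depth : vertex T -> nat,
  [/\ forall v, depth v = 0%N <-> v = r,
      forall e u v, eset S e -> ends e = [set u; v] ->
        depth u = (depth v).+1 \/ depth v = (depth u).+1,
      forall v, v <> r -> exists e u,
        [/\ eset S e, ends e = [set v; u] & depth v = (depth u).+1] &
      forall e f v u w, eset S e -> eset S f -> ends e = [set v; u] ->
        ends f = [set v; w] -> depth v = (depth u).+1 ->
        depth v = (depth w).+1 -> e = f].
Proof.
move=> Stree Sspan; have Sac := is_tree_acyclic Stree.
have [_ Sconn _] := Stree.
have /choice[P PP] : forall v, exists p, [/\ is_path (eset S) v p,
    path_end v p = r & reduced p].
  by move=> v; apply: joined_reduced; exact: Sconn.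
have Puniq v p : is_path (eset S) v p -> path_end v p = r -> reduced p ->
    p = P v.
  move=> pp pr rp; have [pp' pr' rp'] := PP v.
  by apply: (acyclic_uniq Sac pp) => //; rewrite pr pr'.
(* Either [e] starts the path of [u], or putting it in front of that path gives the path of [v]. *)
have step e u v : eset S e -> ends e = [set u; v] ->
    P u = (e, v) :: P v \/ size (P v) = (size (P u)).+1.
  move=> Se uv; have [pp pr rp] := PP u.
  case E: (P u) pp pr rp => [|[f w] q] pp pr rp.
    by right; rewrite -(Puniq v [:: (e, u)])//= uv setUC.
  have [ef|ef] := pselect (e = f).
    subst f; move: pp rp => /= [_ uw qq] [_ rq]; left.
    have vw : v = w by apply: (@set2_inj _ u); rewrite -uv uw.
    by subst w; rewrite (Puniq v q).
  by right; rewrite -(Puniq v [:: (e, u), (f, w) & q])//= uv setUC.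
exists (size \o P); split=> /=.
- move=> v; split=> [/size0nil P0|->].
    by have [_] := PP v; rewrite P0.
  by rewrite -(Puniq r [::]).
- by move=> e u v Se uv; have [->|->] := step e u v Se uv; [left|right].
- move=> v vr; have [pp pr rp] := PP v.
  case E: (P v) pp pr rp => [|[e u] q] //= [Se vu qq] qr [_ rq].
  by exists e, u; split=> //; rewrite (Puniq u q).
- move=> e f v u w Se Sf vu vw Eu Ew.
  have [Pe|Pe] := step _ _ _ Se vu; last lia.
  have [Pf|Pf] := step _ _ _ Sf vw; last lia.
  by move: Pf; rewrite Pe => -[].
Qed.

End SpanningTree.

(** * Groups acting on trees *)

(** Serves to check finiteness orbit by orbit, with [f] an orbit map. *)
Lemma finite_image_fibers X Y Z (A : set X) (f : X -> Y) (g : X -> Z) :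
  finite_set (f @` A) ->
  (forall a, A a -> finite_set (g @` [set b | A b /\ f b = f a])) ->
  finite_set (g @` A).
Proof.
move=> fA fib.
have sub : g @` A `<=`
    \bigcup_(y in f @` A) (g @` [set b | A b /\ f b = y]).
  by move=> _ [a Aa <-]; exists (f a); exists a.
apply: sub_finite_set sub _; apply: bigcup_finite => // _ [a Aa <-].
exact: fib.
Qed.

(** Remove the longest common suffix: what remains is empty on one side or ends in different
    entries. *)
Lemma suffix_split X (p q : seq X) :
  [\/ exists r, p = r ++ q, exists r, q = r ++ p |
      exists a b r p' q', [/\ p = rcons p' a ++ r, q = rcons q' b ++ r & a <> b]].
Proof.
elim/last_ind: p q => [|p a IH] q.
  by constructor 2; exists q; rewrite cats0.
case/lastP: q => [|q b]; first by constructor 1; exists (rcons p a); rewrite cats0.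
have [->|ab] := pselect (a = b); last first.
  by constructor 3; exists a, b, [::], p, q; rewrite !cats0.
case: (IH q) => [[r ->]|[r ->]|[a' [b' [r [p' [q' [-> -> ab]]]]]]].
- by constructor 1; exists r; rewrite rcons_cat.
- by constructor 2; exists r; rewrite rcons_cat.
- by constructor 3; exists a', b', (rcons r b), p', q'; rewrite !rcons_cat.
Qed.

Section GTreeTheory.
Variables (G : groupType) (T : gtree G).
Hypothesis stabT : trivial_edge_stabilisers T.
Implicit Types (u v w : vertex T) (e f : edge T) (g h : G).
Implicit Types (F : set (edge T)) (p q : seq (edge T * vertex T)).

Lemma vactK v g : vact (vact v g) g^-1 = v.
Proof. by rewrite -vactM mulgV vact1. Qed.

Lemma vactVK v g : vact (vact v g^-1) g = v.
Proof. by rewrite -vactM mulVg vact1. Qed.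

Lemma eactK e g : eact (eact e g) g^-1 = e.
Proof. by rewrite -eactM mulgV eact1. Qed.

Lemma vact_inj g u v : vact u g = vact v g -> u = v.
Proof. by move=> E; rewrite -[u](vactK u g) E vactK. Qed.

Lemma eact_inj g e f : eact e g = eact f g -> e = f.
Proof. by move=> E; rewrite -[e](eactK e g) E eactK. Qed.

Lemma eact_free e g h : eact e g = eact e h -> g = h.
Proof.
move=> E; apply: (mulIg h^-1); rewrite mulgV; apply: (stabT (e := e)).
by rewrite eactM E eactK.
Qed.

Lemma ends_act e g u v : ends e = [set u; v] ->
  ends (eact e g) = [set vact u g; vact v g].
Proof.
move=> uv; rewrite ends_eact uv; apply/seteqP; split=> w.
  by move=> [x [->|->] <-]; [left|right].
by move=> [->|->]; [exists u; [left|]|exists v; [right|]].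
Qed.

Lemma ends_act_in e g v : ends e v -> ends (eact e g) (vact v g).
Proof. by move=> ev; rewrite ends_eact; exists v. Qed.

Definition act_path p g := [seq (eact d.1 g, vact d.2 g) | d <- p].

Lemma is_path_act F F' u p g : (forall f, F f -> F' (eact f g)) ->
  is_path F u p -> is_path F' (vact u g) (act_path p g).
Proof.
move=> FF'; elim: p u => // -[e v] p IH u /= [Fe uv pp].
by split; [exact: FF'|exact: ends_act|exact: IH].
Qed.

Lemma path_end_act u p g : path_end (vact u g) (act_path p g) =
  vact (path_end u p) g.
Proof. by elim: p u => // -[e v] p IH u /=; rewrite !path_end_cons IH. Qed.

Lemma reduced_act p g : reduced p -> reduced (act_path p g).
Proof.
elim: p => // -[e v] p IH /= [ep rp]; split; last exact: IH.
by case: p ep {IH rp} => // -[f w] p /= ef /eact_inj.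
Qed.

Lemma act_path_rcons p d g :
  act_path (rcons p d) g = rcons (act_path p g) (eact d.1 g, vact d.2 g).
Proof. exact: map_rcons. Qed.

Lemma joined_act F F' u v g : (forall f, F f -> F' (eact f g)) ->
  joined F u v -> joined F' (vact u g) (vact v g).
Proof.
move=> FF' [p pp <-]; exists (act_path p g); first exact: is_path_act pp.
exact: path_end_act.
Qed.

Lemma gtree_acyclic : acyclic [set: edge T].
Proof. exact: (is_tree_acyclic (gtree_tree T)). Qed.

Lemma gtree_acyclic_sub F : acyclic F.
Proof. by apply: acyclic_sub gtree_acyclic. Qed.

Lemma gtree_joined u v : joined setT u v.
Proof. by have [_ + _] := gtree_tree T; apply. Qed.

Lemma gtree_neq e u v : ends e = [set u; v] -> u <> v.
Proof. by move=> uv E; subst v; exact: (acyclic_no_loop gtree_acyclic I uv). Qed.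

(** * Distances and axes *)

Lemma size_reduced_le u p q : is_path setT u p -> reduced p ->
  is_path setT u q -> path_end u p = path_end u q -> (size p <= size q)%N.
Proof.
move=> pp rp /reduce_path[q' [qq' <- rq' sq]] E.
by rewrite (acyclic_uniq gtree_acyclic pp qq').
Qed.

(** A reduced path is shortest, so the set defining [dist] is nonempty and [dist] is not the default
    value of [xget]. *)
Lemma dist_path u v : exists p, [/\ is_path setT u p, path_end u p = v,
  reduced p & size p = dist u v].
Proof.
have [p [pp pv rp]] := joined_reduced (gtree_joined u v).
have dp : is_dist u v (size p).
  split; first by exists p.
  by move=> q qq qv; apply: (@size_reduced_le u) => //; rewrite pv qv.
have [[p' [pp' pv' sp']] pmin] : is_dist u v (dist u v).
  exact: (@xgetPex _ 0%N [set n | is_dist u v n] (ex_intro _ _ dp)).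
exists p; split=> //; apply/eqP; rewrite eqn_leq pmin//= -sp' andbT.
by apply: (@size_reduced_le u) => //; rewrite pv pv'.
Qed.

Lemma dist_le u v p : is_path setT u p -> path_end u p = v ->
  (dist u v <= size p)%N.
Proof.
move=> pp pv; have [q [qq qv rq <-]] := dist_path u v.
by apply: (@size_reduced_le u) => //; rewrite qv pv.
Qed.

(** The path [p] followed by its translates under [g], [g ^+ 2] and so on, [n] pieces in all. *)
Fixpoint iter_path p g n :=
  if n is m.+1 then p ++ act_path (iter_path p g m) g else [::].

Lemma iter_pathP u p g n : is_path setT u p -> path_end u p = vact u g ->
  [/\ is_path setT u (iter_path p g n),
      path_end u (iter_path p g n) = vact u (g ^+ n) &
      size (iter_path p g n) = (n * size p)%N].
Proof.
move=> pp pu; elim: n => [|n [IH1 IH2 IH3]] /=; first by rewrite expg0 vact1.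
split.
- by apply/is_path_cat; rewrite pu; split=> //; exact: is_path_act IH1.
- by rewrite path_end_cat pu path_end_act IH2 expgSr vactM.
- by rewrite size_cat size_map IH3 mulSn.
Qed.

(* The edge [e], directed from [u] to [v], and its translate by [g] point the
   same way along a reduced path. *)
Definition coherent e u v g := exists q,
  [/\ is_path setT u ((e, v) :: q), path_end v q = vact u g &
      reduced (rcons ((e, v) :: q) (eact e g, vact v g))].

(** The pieces of [iter_path] fit into a reduced path, which is shortest. Compare it with the detour
    from [u] to [w], along [r] and its translates, and back. *)
Lemma coherent_displacement e u v g q w r :
  is_path setT u ((e, v) :: q) -> path_end v q = vact u g ->
  reduced (rcons ((e, v) :: q) (eact e g, vact v g)) ->
  is_path setT w r -> path_end w r = vact w g ->
  (size ((e, v) :: q) <= size r)%N.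
Proof.
set p := (e, v) :: q => pp pu rp rr rw.
have [s ss su] := gtree_joined u w.
(* The detour gives m |p| <= m |r| + 2 |s|, hence |p| <= |r| as soon as m exceeds 2 |s|. *)
pose m := (2 * size s).+1.
have [P1 P2 P3] := iter_pathP m pp pu.
have [R1 R2 R3] := iter_pathP m rr rw.
have iter_red k : reduced (iter_path p g k).
  elim: k => // -[|k] IH.
    rewrite [iter_path _ _ _]cats0; apply: (@reduced_catl _ _ [:: (eact e g, vact v g)]).
    by rewrite cats1.
  rewrite [iter_path _ _ _]/(p ++ act_path (iter_path p g k.+1) g).
  have /= IHg := reduced_act g IH; exact: (@reduced_glue _ p) rp IHg.
pose c := s ++ iter_path r g m ++ act_path (reversal u s) (g ^+ m).
have revs : is_path setT (vact w (g ^+ m)) (act_path (reversal u s) (g ^+ m)).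
  by rewrite -su; apply: is_path_act (is_path_rev ss).
have cc : is_path setT u c.
  apply/is_path_cat; rewrite su; split=> //; apply/is_path_cat; split=> //.
  by move: (g ^+ m) R2 revs => gm ->.
have cu : path_end u c = vact u (g ^+ m).
  by rewrite path_end_cat su path_end_cat R2 path_end_act -su path_end_rev.
have := size_reduced_le P1 (iter_red m) cc.
rewrite P2 cu => /(_ erefl); rewrite P3 size_cat size_cat R3 size_map size_reversal.
by rewrite /m; nia.
Qed.

(** Both [u] and [v] are displaced by the length of the path, which is positive and, by
    [coherent_displacement], minimal. *)
Lemma coherent_axis e u v g : coherent e u v g ->
  hyperbolic T g /\ ends e `<=` min_displaced (T := T) g.
Proof.
move=> [q [pp pu rp]].
have disp := coherent_displacement pp pu rp.
split; first by move=> [w wg]; have := disp w [::] I (esym wg).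
have uv : ends e = [set u; v] by move: pp => /= [].
have mind z r : is_path setT z r -> path_end z r = vact z g ->
    size r = size ((e, v) :: q) -> min_displaced (T := T) g z.
  move=> rr rz sr w; apply: leq_trans (dist_le rr rz) _; rewrite sr.
  by have [t [tt tw _ <-]] := dist_path w (vact w g); exact: disp tt tw.
rewrite uv => _ [->|->]; first exact: mind pp pu _.
apply: (mind v (rcons q (eact e g, vact v g))); last by rewrite size_rcons.
  rewrite -cats1; apply/is_path_cat; split; first by move: pp => [].
  by rewrite pu /=; split=> //; exact: ends_act.
by rewrite path_end_rcons.
Qed.

(* Two directed edges that both point to a common place either point one to
   the other or point towards each other. *)
Lemma facing u u' p p' z e e' v v' : is_path setT u ((e, v) :: p) ->
  is_path setT u' ((e', v') :: p') -> reduced ((e, v) :: p) ->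
  reduced ((e', v') :: p') -> path_end v p = z -> path_end v' p' = z ->
  (size p' < size p)%N ->
  (exists q, [/\ is_path setT u ((e, v) :: q), path_end v q = u' &
     reduced (rcons ((e, v) :: q) (e', v'))]) \/
  (exists q, [/\ is_path setT u ((e, v) :: q), path_end v q = u',
     reduced ((e, v) :: q) & exists q', (e, v) :: q = rcons q' (e', u')]).
Proof.
move=> pp pp' rp rp' pz pz' spp.
case: (suffix_split ((e, v) :: p) ((e', v') :: p')) => [[r E]|[r E]|].
- left; case: r E => [|d r] E.
    by have := congr1 size E => /= -[] sE; move: spp; rewrite sE ltnn.
  case: E => Ed Ep; subst d; exists r.
  move: pp rp; rewrite Ep -cat_cons => /is_path_cat[rr pp2] rp.
  split=> //; last by rewrite -cats1; apply: (@reduced_catl _ _ p'); rewrite -catA.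
  move: pp2 => /= [_ E _]; move: pp' => /= [_ E' _].
  by apply: (@set2_inj _ v'); rewrite setUC -E E' setUC.
- by move: spp; have := congr1 size E; rewrite size_cat /= => ?; lia.
(* The paths merge right after [a] and [b]: follow the first one to the merging point, then the
   second one backwards until [e'] has been crossed. *)
move=> [a [b [r [q1 [q2 [E E' ab]]]]]]; right.
move: (pp) (pp') (rp) (rp'); rewrite E E'.
move=> /is_path_cat[aa ar] /is_path_cat[bb br] /reduced_catl ra /reduced_catl rb.
have ab2 : a.2 = b.2.
  rewrite !path_end_rcons in ar br.
  case: r E E' ar br => [|[f w] r] E E' /= ar br.
    move: (path_end_cons u p (e, v)) (path_end_cons u' p' (e', v')).
    by rewrite E E' !cats0 !path_end_rcons pz pz' => -> ->.
  apply: (@set2_inj _ w); case: ar => _ A _; case: br => _ B _.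
  by rewrite setUC -A B setUC.
have ab1 : a.1 <> b.1.
  by move=> ab1; apply: ab; case: (a) (b) ab1 ab2 => ? ? [? ?] /= -> ->.
have eb : exists s, rcons q2 b = (e', v') :: s.
  by case: (q2) E' => [|d s] /= [<- _]; [exists [::]|exists (rcons s b)].
have ea : exists s, rcons q1 a = (e, v) :: s.
  by case: (q1) E => [|d s] /= [<- _]; [exists [::]|exists (rcons s a)].
move: eb ea => [sb Eb] [sa Ea].
have Er : exists c s, reversal u' (rcons q2 b) = (b.1, c) :: s.
  rewrite -cats1 reversal_cat; case: (b) => b1 b2 /=.
  by exists (path_end u' q2), (reversal u' q2).
have [c [s Ers]] := Er.
exists (sa ++ reversal u' (rcons q2 b)); rewrite -cat_cons -Ea; split.
- apply/is_path_cat; split=> //; have := is_path_rev bb.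
  by rewrite !path_end_rcons ab2.
- rewrite -[path_end _ _]/(path_end u ((e, v) :: sa ++ _)) -cat_cons -Ea.
  by rewrite path_end_cat path_end_rcons ab2 -(path_end_rcons u' q2 b) path_end_rev.
- rewrite Ers; apply: reduced_junction => //; rewrite -Ers.
  exact: reduced_rev rb.
- exists ((rcons q1 a) ++ reversal v' sb).
  by rewrite Eb /= rcons_cat.
Qed.

End GTreeTheory.

(** * Rays in a set of edges with finitely many orbits under a subgroup *)

Section Subgroup.
Variables (G : groupType) (T : gtree G).
Hypothesis stabT : trivial_edge_stabilisers T.
Variable H : {pred G}.
Hypothesis grpH : group_closed H.
Implicit Types (u v w : vertex T) (e f : edge T) (g h : G).
Implicit Types (F : set (edge T)) (p q : seq (edge T * vertex T)).

Let H1 : 1 \in H. Proof. by case: grpH. Qed.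
Let HV h : h \in H -> h^-1 \in H. Proof. exact: group_closedV. Qed.
Let HM g h : g \in H -> h \in H -> g * h \in H.
Proof. exact: group_closedM. Qed.

Lemma vorbit_refl v : vorbit H v v.
Proof. by exists 1; rewrite ?vact1. Qed.

Lemma eorbit_refl e : eorbit H e e.
Proof. by exists 1; rewrite ?eact1. Qed.

Lemma vorbit_act v h : h \in H -> vorbit H (vact v h) = vorbit H v.
Proof.
move=> Hh; apply/seteqP; split=> _ [k Hk ->].
  by exists (h * k); [exact: HM|rewrite vactM].
by exists (h^-1 * k); [exact: HM (HV Hh) Hk|rewrite -vactM mulgA mulgV mul1g].
Qed.

Lemma eorbit_act e h : h \in H -> eorbit H (eact e h) = eorbit H e.
Proof.
move=> Hh; apply/seteqP; split=> _ [k Hk ->].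
  by exists (h * k); [exact: HM|rewrite eactM].
by exists (h^-1 * k); [exact: HM (HV Hh) Hk|rewrite -eactM mulgA mulgV mul1g].
Qed.

Lemma vorbit_eq u v : vorbit H u = vorbit H v ->
  exists2 h, h \in H & v = vact u h.
Proof. by move=> E; have := vorbit_refl v; rewrite -E. Qed.

Lemma eorbit_eq e f : eorbit H e = eorbit H f ->
  exists2 h, h \in H & f = eact e h.
Proof. by move=> E; have := eorbit_refl f; rewrite -E. Qed.

(** A directed edge is encoded by its initial vertex and its edge. An orbit of edges yields at most
    two orbits of directed edges, so the pigeonhole principle applies. *)
Lemma ray_return F x y (N : nat) : ray F x y -> finite_set (eorbit H @` F) ->
  exists i j h, [/\ (N <= i)%N, (i < j)%N, h \in H,
    x j = vact (x i) h & y j = eact (y i) h].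
Proof.
move=> r finF.
pose dorb i := [set d : vertex T * edge T |
  exists2 h, h \in H & d = (vact (x i) h, eact (y i) h)].
have [|i [j [Ni ij E]]] := @finite_image_nat _ dorb N.
  apply: (@finite_image_fibers _ _ _ setT (fun i => eorbit H (y i))).
    apply: sub_finite_set finF => _ [i _ <-].
    by exists (y i) => //; have [] := r i.
  move=> a _; have [_ Ea _] := r a.
  pose rev_orb := [set d : vertex T * edge T |
    exists2 h, h \in H & d = (vact (x a.+1) h, eact (y a) h)].
  apply: (sub_finite_set (B := [set dorb a; rev_orb])).
    move=> _ [b [_ /esym/eorbit_eq[h Hh yb]] <-].
    have [_ Eb _] := r b; rewrite yb (ends_act _ Ea) in Eb.
    have key c : x b = vact c h -> dorb b = [set d : vertex T * edge T |
        exists2 h, h \in H & d = (vact c h, eact (y a) h)].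
      move=> xb; apply/seteqP; split=> _ [k Hk ->].
        by exists (h * k); [exact: HM|rewrite xb yb vactM eactM].
      exists (h^-1 * k); first exact: HM (HV Hh) Hk.
      by rewrite xb yb -vactM -eactM mulgA mulgV mul1g.
    by have [[/esym/key ? _]|[_ /esym/key ?]] := set2_eq Eb; [left|right].
  exact: finite_set2.
have : dorb j (x j, y j) by exists 1; rewrite ?vact1 ?eact1.
by rewrite -E => -[h Hh [xj yj]]; exists i, j, h.
Qed.

(** The ray crosses some [y i] and later its translate by [h] in the corresponding direction. So the
    first edge and its translate by [h] both point to [x j.+1], and [facing] applies. *)
Lemma ray_turn F x y : ray F x y -> finite_set (eorbit H @` F) ->
  let e := y 0%N in let u := x 0%N in let v := x 1%N in
  exists2 h, h \in H & coherent e u v h \/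
    exists q, [/\ is_path setT u ((e, v) :: q), path_end v q = vact u h,
      reduced ((e, v) :: q) &
      exists q', (e, v) :: q = rcons q' (eact e h, vact u h)].
Proof.
move=> r finF e u v.
have [i [j [h [_ ij Hh xj yj]]]] := ray_return 0 r finF.
exists h => //.
have rT : ray setT x y by move=> k; have [_ ? ?] := r k.
pose p1 := segment x y 1 j; pose p2 := act_path (segment x y 1 i) h.
have P1 : is_path setT u ((e, v) :: p1) := is_path_segment rT 0 j.+1.
have P2 : is_path setT (vact u h) ((eact e h, vact v h) :: p2).
  by apply: is_path_act (is_path_segment rT 0 i.+1).
have R1 : reduced ((e, v) :: p1) := reduced_segment rT 0 j.+1.
have R2 : reduced ((eact e h, vact v h) :: p2).
  exact: (reduced_act h (reduced_segment rT 0 i.+1)).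
have E1 : path_end v p1 = x j.+1 by rewrite path_end_segment add1n.
have E2 : path_end (vact v h) p2 = x j.+1.
  rewrite path_end_act path_end_segment add1n.
  have [_ ei _] := r i; have [_ ej _] := r j.
  have := ends_act h ei; rewrite -yj ej xj => E.
  by rewrite (set2_inj E).
have sp : (size p2 < size p1)%N by rewrite !size_map !size_iota.
have [] := facing P1 P2 R1 R2 E1 E2 sp; first by left.
by right.
Qed.

(** If neither ray gives a coherent translate, then [e] faces its translate by some [h] and, read
    backwards, its translate by some [k]. Composing the two turns makes [e] coherent with its
    translate by [k * h]. *)
Lemma halfrays_axis F e u v : finite_set (eorbit H @` F) ->
  halfray (fun _ _ => True) F e u v -> halfray (fun _ _ => True) F e v u ->
  exists h, [/\ h \in H, hyperbolic T h & ends e `<=` min_displaced (T := T) h].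
Proof.
move=> finF [x [y [r y0 x0 x1 _]]] [x' [y' [r' y'0 x'0 x'1 _]]].
have uv : ends e = [set u; v] by rewrite -y0 -x0 -x1; have [] := r 0%N.
have [h Hh] := ray_turn r finF; rewrite y0 x0 x1 => -[/coherent_axis[]|A].
  by exists h.
have [k Hk] := ray_turn r' finF; rewrite y'0 x'0 x'1 => -[/coherent_axis[]|B].
  by exists k.
move: A B => [q [qq qh rq [q' Eq]]] [r1 [rr rk red [r2 Er]]].
(* The path from [e] to its reversed translate by [h] is glued to the [h]-translate of the other
   path; they overlap in [eact e h]. *)
suff /coherent_axis[hyp sub] : coherent e u v (k * h).
  by exists (k * h); split=> //; exact: HM.
case: q' Eq => [|d q'] Eq.
  case: Eq => eh vh _; have h1 : h = 1 by apply: (stabT (e := e)).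
  by have := gtree_neq uv; rewrite vh h1 vact1.
case: Eq => Ed Eq; subst d.
have qq' : is_path setT u ((e, v) :: q').
  by move: qq; rewrite Eq -cats1 -cat_cons => /is_path_cat[].
have qend : path_end v q' = vact v h.
  move: qq; rewrite Eq -cats1 -cat_cons => /is_path_cat[_ [_ E _]].
  apply: (@set2_inj _ (vact u h)); rewrite -(ends_act h uv) setUC -E.
  by [].
have Erh : (eact e h, vact u h) :: act_path r1 h =
    rcons (act_path r2 h) (eact e (k * h), vact v (k * h)).
  by rewrite eactM vactM -(act_path_rcons r2 (eact e k, vact v k)) -Er.
have full : is_path setT u (((e, v) :: q') ++ (eact e h, vact u h) :: act_path r1 h).
  apply/is_path_cat; split=> //; rewrite path_end_cons /= qend.
  by have := @is_path_act _ _ setT setT v ((e, u) :: r1) h (fun _ _ => I) rr.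
exists (q' ++ act_path r2 h); split.
- by move: full; rewrite Erh -cats1 catA => /is_path_cat[].
- move: full; rewrite Erh -cats1 catA => /is_path_cat[_ [_ E _]].
  apply: (@set2_inj _ (vact v (k * h))); rewrite setUC.
  rewrite -[path_end v _]/(path_end u ((e, v) :: q' ++ act_path r2 h)).
  by rewrite -cat_cons -E (ends_act _ uv) setUC.
- rewrite -cats1 -cat_cons -catA cats1 -Erh.
  apply: reduced_glue; first by rewrite rcons_cons -Eq.
  exact: (reduced_act h red).
Qed.

Lemma line_minimal_subtree F vs es (j : int) : finite_set (eorbit H @` F) ->
  reduced_line F vs es -> eset (minimal_subtree T H) (es j).
Proof.
move=> finF r; have [_ E _] := r j.
(* For the relation that always holds, every edge of a line is a largest one, so the line splits
   into half-rays at any edge. *)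
have b : bridge_in (fun _ _ => True) F (es j).
  by exists vs, es; split=> //; exists j.
have [h1 h2] := bridge_halfrays b E.
have [h [Hh hyp sub]] := halfrays_axis finF h1 h2.
have hyps : hyperbolics T H h by [].
rewrite /minimal_subtree; case: pselect => [hne|[]]; last by exists h.
by exists h.
Qed.

End Subgroup.

(** * Bridges and descending rays *)

Section Bridges.
Variables (G : groupType) (T : gtree G).
Hypothesis stabT : trivial_edge_stabilisers T.
Variable H : {pred G}.
Hypothesis grpH : group_closed H.
Variable le : edge T -> edge T -> Prop.
Hypothesis le_trans : forall x y z, le x y -> le y z -> le x z.
Hypothesis le_total : forall x y, le x y \/ le y x.
Hypothesis le_act : forall x y g, le x y -> le (eact x g) (eact y g).
Variable P : set (edge T).
Hypothesis P_act : forall e h, h \in H -> P e -> P (eact e h).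
Hypothesis finP : finite_set (eorbit H @` P).
Implicit Types (u v w x y z : vertex T) (e f g : edge T) (h k l : G).
Implicit Types (p q : seq (edge T * vertex T)).

Let HV h : h \in H -> h^-1 \in H. Proof. exact: group_closedV. Qed.
Let HM h k : h \in H -> k \in H -> h * k \in H.
Proof. exact: group_closedM. Qed.
Let le_refl e : le e e. Proof. by case: (le_total e e). Qed.

Definition trivial v := ~ nontrivial_stabiliser H v.

Lemma trivialP v h : trivial v -> h \in H -> vact v h = v -> h = 1.
Proof.
by move=> tv Hh vh; apply: contrapT => h1; apply: tv; exists h.
Qed.

Lemma trivial_act v h : h \in H -> trivial v -> trivial (vact v h).
Proof.
move=> Hh tv [k [Hk k1 vk]]; apply: k1.
have : h * k * h^-1 = 1.
  apply: (trivialP tv); first by apply: HM; [exact: HM|exact: HV].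
  by rewrite !vactM vk vactK.
by move=> /divg1_eq E; apply: (mulgI h); rewrite E mulg1.
Qed.

(** An orbit has at most two edges at [v]: one for each end that can be moved to [v], since the
    element moving it is unique when the stabiliser is trivial. *)
Lemma finite_edges_at v : trivial v -> finite_set [set f | P f /\ ends f v].
Proof.
move=> tv.
suff : finite_set (id @` [set f | P f /\ ends f v]) by rewrite image_id.
apply: (finite_image_fibers (f := eorbit H)).
  by apply: sub_finite_set finP => _ [f [Pf _] <-]; exists f.
move=> f [Pf fv]; have [w vw] := other_end fv.
have vinj k l : k \in H -> l \in H -> vact w k = v -> vact w l = v -> k = l.
  move=> Hk Hl wk wl; apply: (mulgI k^-1); rewrite mulVg; apply/esym.
  apply: (trivialP tv); first by apply: HM => //; exact: HV.
  by rewrite vactM -{1}wk vactK.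
have [[k [Hk wk]]|nex] := pselect (exists k, k \in H /\ vact w k = v); last first.
  apply: (sub_finite_set (B := [set f])); last exact: finite_set1.
  move=> _ [f' [[_ f'v] /esym/(eorbit_eq grpH)[h Hh E]] <-]; subst f'; move: f'v.
  rewrite (ends_act h vw) => -[/esym/(trivialP tv Hh) ->|E].
    by rewrite eact1.
  by case: nex; exists h.
apply: (sub_finite_set (B := [set f; eact f k])); last exact: finite_set2.
move=> _ [f' [[_ f'v] /esym/(eorbit_eq grpH)[h Hh E]] <-]; subst f'; move: f'v.
rewrite (ends_act h vw) => -[/esym/(trivialP tv Hh) ->|E].
  by left; rewrite eact1.
by right; rewrite (vinj h k).
Qed.

(** * Clusters of smaller edges *)

Definition below e := [set f | [/\ P f, le f e & f <> e]].

Definition below_eq e := [set f | P f /\ le f e].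

Definition cluster e u := [set x | joined (below e) u x].

(* The clusters are the components that Kruskal's algorithm has built when it
   reaches [e]. No descending ray crosses [e] towards a dead end. *)
Definition dead e u := finite_set (cluster e u) /\ cluster e u `<=` trivial.

Lemma below_sub e : below e `<=` below_eq e.
Proof. by move=> f []. Qed.

Lemma below_act e h : h \in H ->
  forall f, below e f -> below (eact e h) (eact f h).
Proof.
move=> Hh f [Pf fe nfe]; split; [exact: P_act|exact: le_act|].
by move=> /eact_inj.
Qed.

Lemma below_eq_trans b b' : le b b' -> below_eq b `<=` below_eq b'.
Proof. by move=> bb' f [Pf fb]; split=> //; exact: le_trans bb'. Qed.

Lemma cluster_act e u h x : h \in H ->
  cluster e u x -> cluster (eact e h) (vact u h) (vact x h).
Proof. by move=> Hh; apply: joined_act; exact: below_act. Qed.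

Lemma cluster_actV e u h x : h \in H ->
  cluster (eact e h) (vact u h) x -> cluster e u (vact x h^-1).
Proof. by move=> Hh /(cluster_act (HV Hh)); rewrite eactK vactK. Qed.

Lemma dead_act e u h : h \in H -> dead e u -> dead (eact e h) (vact u h).
Proof.
move=> Hh [fin triv]; split.
  have sub : cluster (eact e h) (vact u h) `<=`
      (fun x => vact x h) @` cluster e u.
    by move=> x /(cluster_actV Hh) cx; exists (vact x h^-1); rewrite ?vactVK.
  by apply: sub_finite_set sub _; exact: finite_image.
move=> x /(cluster_actV Hh)/triv/(trivial_act Hh).
by rewrite vactVK.
Qed.

Lemma dead_actV e u h : h \in H -> dead (eact e h) (vact u h) -> dead e u.
Proof. by move=> Hh /(dead_act (HV Hh)); rewrite eactK vactK. Qed.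

(** * Construction of descending rays *)

Definition beyond b f y := [set z | exists q,
  [/\ is_path (below b) y q, reduced ((f, y) :: q) & path_end y q = z]].

Definition infinite_state x f y b :=
  [/\ P f, ends f = [set x; y], le f b, infinite_set (beyond b f y) &
      beyond b f y `<=` trivial].

(* The last edge crossed is [f], from [x] to [y], and the path has to go on with
   edges bounded by [b]. *)
Definition state x f y b := infinite_state x f y b \/
  [/\ P f, ends f = [set x; y], b = f, ~ dead f x & ~ dead f y].

(** The invariant of the construction: a reduced path crosses [f] first, uses edges bounded by [b]
    and ends in a [state]. Its variant [advances] demands at least one edge after [f]. *)
Definition continues x f y b := exists q p' f' y' b',
  [/\ is_path (below_eq b) x ((f, y) :: q), reduced ((f, y) :: q),
      (f, y) :: q = rcons p' (f', y'), state (path_end x p') f' y' b' &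
      le b' b].

Definition advances x f y b := exists d q p' f' y' b',
  [/\ is_path (below_eq b) x [:: (f, y), d & q], reduced [:: (f, y), d & q],
      [:: (f, y), d & q] = rcons p' (f', y'),
      state (path_end x p') f' y' b' & le b' b].

(* One step of the proof of Koenig's lemma. *)
Lemma infinite_state_advances x f y b :
  infinite_state x f y b -> advances x f y b.
Proof.
move=> [Pf xy fb Binf Btriv].
suff [g [z [bg gf yz ginf]]] : exists g z, [/\ below b g, g <> f,
    ends g = [set y; z] & infinite_set (beyond b g z)].
  have [Pg gb _] := bg.
  exists (g, z), [::], [:: (f, y)], g, z, b; split=> //=.
    by split=> //; exact: nesym.
  left; split=> // t [q [qq rq qt]]; apply: Btriv; exists ((g, z) :: q).
  by split=> //=; split=> //; exact: nesym.
apply: contrapT => nex; apply: Binf.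
pose B g := [set t | exists z, [/\ below b g, g <> f, ends g = [set y; z] &
  beyond b g z t]].
have sub : beyond b f y `<=`
    y |` \bigcup_(g in [set g | P g /\ ends g y]) B g.
  move=> t [[|[g z] q] [qq rq qt]]; first by left.
  move: qq rq qt => /= [bg yz qq] [fg rq] qt; right; exists g.
    by split; [case: bg|rewrite yz; left].
  by exists z; split=> //; [exact: nesym|exists q].
apply: sub_finite_set sub _; rewrite finite_setU; split; first exact: finite_set1.
have ty : trivial y by apply: Btriv; exists [::].
apply: bigcup_finite; first exact: finite_edges_at.
move=> g _; have [[z [bg gf yz]]|nz] := pselect (exists z,
    [/\ below b g, g <> f & ends g = [set y; z]]); last first.
  apply: (sub_finite_set (B := set0)); last exact: finite_set0.
  by move=> t [z [? ? ? _]]; apply: nz; exists z.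
apply: (sub_finite_set (B := beyond b g z)).
  by move=> t [z' [_ _ yz' ?]]; rewrite (@set2_inj _ y z z')// -yz yz'.
by apply: contrapT => ginf; apply: nex; exists g, z.
Qed.

(** In a state of the second kind, either the cluster of [y] has only trivial stabilisers, and is
    infinite since it is not dead, or it contains a vertex around which the path can turn back to a
    translate of [f]. *)
Lemma state_advances x f y b : state x f y b -> advances x f y b.
Proof.
case=> [|[Pf xy -> dx dy]]; first exact: infinite_state_advances.
have redP q : is_path (below f) y q -> reduced q -> reduced ((f, y) :: q).
  case: q => [|[g z] q]; first by [].
  by move=> /= [[_ _ gf] _ _] rq; split=> //; exact: nesym.
have [triv|] := pselect (cluster f y `<=` trivial).
  apply: infinite_state_advances; split=> //.
    move=> fin; apply: dy; split=> //; apply: sub_finite_set fin => z.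
    by move=> /joined_reduced[q [qq qz rq]]; exists q; split=> //; exact: redP.
  by move=> z [q [qq _ qz]]; apply: triv; exists q.
move=> /existsNP[z /not_implyP[/joined_reduced[q [qq qz rq]] /contrapT]].
move=> [l0 [Hl0 l01 zl0]].
(* Go from [f] to [z] and come back along the translate by [l]. *)
have [l [Hl l1 zl lf]] : exists l,
    [/\ l \in H, l <> 1, vact z l = z & le (eact f l) f].
  (* If [l0] increases [f], its inverse decreases [f], as the order is invariant. *)
  have [l0f|fl0] := le_total (eact f l0) f; first by exists l0.
  exists l0^-1; split; first exact: HV.
  - by move=> E; apply: l01; rewrite -[l0]invgK E invg1.
  - by rewrite -{1}zl0 vactK.
  - by rewrite -{2}[f](eactK f l0); exact: le_act.
pose p := (f, y) :: q.
have pp : is_path (below_eq f) x p.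
  by split=> //; apply: is_path_sub qq; exact: below_sub.
have pz : path_end x p = z by [].
have rp : reduced p by exact: redP.
pose p2 := act_path (reversal x p) l.
have p2p : is_path (below_eq f) z p2.
  have := is_path_rev pp; rewrite pz -{2}zl.
  apply: is_path_act => g [Pg gf].
  by split; [exact: P_act|exact: le_trans (le_act _ gf) lf].
have rp2 : reduced p2 by apply: reduced_act; exact: reduced_rev.
have Ep2 : p2 = rcons (act_path (reversal y q) l) (eact f l, vact x l).
  by rewrite /p2 /= act_path_rcons.
(* The two halves meet at [z] in an edge [a] and its translate by [l], which differ because edge
   stabilisers are trivial. *)
have rr : reduced (p ++ p2).
  case/lastP: p pz rp @p2 rp2 {pp p2p Ep2} => [|p' [a c]] pz rp p2 rp2 //.
  have [c' [s Er]] : exists c' s, p2 = (eact a l, c') :: s.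
    rewrite /p2 -cats1 reversal_cat /=.
    by eexists; eexists.
  rewrite Er; apply: reduced_junction; rewrite -?Er//= => /esym/stabT.
  exact: l1.
have [d [s Eds]] : exists d s, q ++ p2 = d :: s.
  by rewrite Ep2; case: (q) => [|d s]; [case: act_path => [|d s]|];
    eexists; eexists.
exists d, s, (p ++ act_path (reversal y q) l), (eact f l), (vact x l), (eact f l).
split=> //.
- by rewrite -Eds -cat_cons; apply/is_path_cat; rewrite pz.
- by rewrite -Eds.
- by rewrite -Eds -cat_cons Ep2 rcons_cat.
- have -> : path_end x (p ++ act_path (reversal y q) l) = vact y l.
    rewrite path_end_cat pz -{1}zl path_end_act -qz.
    by rewrite path_end_rev.
  right; split=> //.
  + exact: P_act.
  + by rewrite (ends_act l xy) setUC.
  + by move/(dead_actV Hl).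
  + by move/(dead_actV Hl).
Qed.

(** Prolong the path by [state_advances] if it consists of [f] alone, then drop its first edge. *)
Lemma continues_step x f y b : continues x f y b ->
  exists g z, f <> g /\ continues y g z b.
Proof.
move=> [q [p' [f' [y' [b' [pp rp E st b'b]]]]]].
wlog [d [s qE]] : q p' f' y' b' pp rp E st b'b / exists d s, q = d :: s.
  case: q pp rp E => [|d s] pp rp E; last by apply; eauto.
  case: p' E st => [|? []]// [<- <-] /state_advances.
  move=> [d [s [p2 [f2 [y2 [b2 [pp2 rp2 E2 st2 b2b]]]]]]].
  move=> /(_ (d :: s) p2 f2 y2 b2); apply=> //; last by exists d, s.
    by apply: is_path_sub pp2; exact: below_eq_trans.
  exact: le_trans b'b.
subst q; case: d pp rp E => g z pp rp E.
case: p' E st => [//|d' p'] [<- E] st.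
move: pp rp => /= [bf xy pp] [fg rp].
by exists g, z; split=> //; exists s, p', f', y', b'.
Qed.

(** Iterate [continues_step], keeping the bound [f] throughout. *)
Lemma state_halfray x f y : state x f y f -> halfray le P f x y.
Proof.
move=> st.
pose Q (t : vertex T * edge T * vertex T) := continues t.1.1 t.1.2 t.2 f.
pose R (t t' : vertex T * edge T * vertex T) :=
  t.1.2 <> t'.1.2 /\ t'.1.1 = t.2.
have [[[x' f'] y'] /=| |t [t0 tQR]] := @dependent_choice _ Q R (x, f, y).
- move=> /continues_step[g [z [fg c]]].
  by exists (y', g, z).
- have [Pf xy] : P f /\ ends f = [set x; y] by case: st => -[].
  by exists [::], [::], f, y, f; split.
have step i : [/\ P (t i).1.2, ends (t i).1.2 = [set (t i).1.1; (t i).2] &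
    le (t i).1.2 f].
  by have [[q [? [? [? [? [+ _ _ _ _]]]]]] _] := tQR i => /= -[[? ?] ?].
exists (fun i => (t i).1.1), (fun i => (t i).1.2); split; rewrite ?t0//.
- move=> i; have [Pi Ei _] := step i; have [_ [ni xi]] := tQR i.
  by rewrite xi.
- by have [_ [_ ->]] := tQR 0%N; rewrite t0.
- by move=> i; have [] := step i.
Qed.

Lemma live_bridge e u v : P e -> ends e = [set u; v] ->
  ~ dead e u -> ~ dead e v -> bridge_in le P e.
Proof.
move=> Pe uv du dv; apply: (halfrays_bridge uv); apply: state_halfray.
  by right.
by right; split=> //; rewrite setUC.
Qed.

(** A half-ray crossing [e] towards [u] stays in the finite cluster of [u], although its vertices
    are pairwise distinct. *)
Lemma dead_not_bridge e u : ends e u -> dead e u -> ~ bridge_in le P e.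
Proof.
move=> eu [fin _] b; have [v uv] := other_end eu.
have [_ [x [y [r y0 x0 x1 ymax]]]] := bridge_halfrays b uv.
have ac := @gtree_acyclic_sub G T P.
have cx i : cluster e u (x i.+1).
  exists (segment x y 1 i); last by rewrite -x1 (path_end_segment _ y).
  elim: i => [//|i IH]; rewrite -(addn1 i) segment_cat.
  apply/is_path_cat; split=> //; rewrite -x1 path_end_segment /=.
  have [Py E _] := r (1 + i)%N; split; [split=> //|exact: E|by []].
  by rewrite -y0; apply: nesym; exact: (ray_edge_inj r).
have [|i [j [_ ij]]] := @finite_image_nat _ (fun i => x i.+1) 0.
  by apply: sub_finite_set fin => _ [i _ <-].
exact: (ray_inj r).
Qed.

End Bridges.

(** * An invariant order on the vertices *)

Section VertexOrder.

Lemma total_order_exists (X : Type) : exists R : rel X, total_order R.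
Proof.
have key (Y : eqType) : exists R : rel Y, total_order R.
  have [R wo] := @wochoice.well_ordering_principle Y; exists R.
  have wo' : wochoice.wo_chain R predT by move=> A _; exact: wo.
  have Rrefl x : R x x by exact: (wochoice.wo_chain_reflexive wo').
  have Ranti x y : R x y && R y x -> x = y.
    exact: (wochoice.wo_chain_antisymmetric wo').
  have Rtot x y : R x y || R y x by exact: (wochoice.wo_chainW wo').
  split=> // y x z Rxy Ryz.
  have [|m [[mA mmin] _]] := wo (pred3 x y z); first by exists x; rewrite !inE eqxx.
  have mx : R m x by apply: mmin; rewrite !inE eqxx.
  have my : R m y by apply: mmin; rewrite !inE eqxx orbT.
  have mz : R m z by apply: mmin; rewrite !inE eqxx !orbT.
  move: mA; rewrite !inE => /or3P[] /eqP mE; subst m => //.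
    by rewrite (Ranti x y)// Rxy.
  by rewrite -(Ranti y z) ?Ryz.
exact: (key {classic X}).
Qed.

Variables (G : groupType) (T : gtree G).
Variable H : {pred G}.
Hypothesis grpH : group_closed H.
Variable leG : rel G.
Hypothesis leG_order : total_order leG.
Hypothesis leG_inv : right_invariant leG.

(** Lexicographic order on the orbit representative [s v] and the coordinate [k v], where [v] is the
    translate of [s v] by [k v]. The coordinate is unique when the stabiliser is trivial, and then
    translation by [h] multiplies it by [h]; hence the restriction in the invariance. *)
Lemma vertex_order : exists vle : vertex T -> vertex T -> Prop,
  [/\ forall x y z, vle x y -> vle y z -> vle x z,
      forall x y, vle x y \/ vle y x,
      forall x y, vle x y -> vle y x -> x = y &
      forall x y h, h \in H -> trivial H x -> trivial H y ->
        vle x y -> vle (vact x h) (vact y h)].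
Proof.
have [[v0 _] _ _] := gtree_tree T.
have [leG_refl leG_anti leG_trans leG_total] := leG_order.
have [R [Rrefl Ranti Rtrans Rtot]] := total_order_exists (vertex T).
have /choice[r rP] : forall O : set (vertex T), exists v, O !=set0 -> O v.
  move=> O; have [[v Ov]|nO] := pselect (O !=set0); first by exists v.
  by exists v0.
have /choice[k kP] : forall v, exists k, k \in H /\ v = vact (r (vorbit H v)) k.
  move=> v; have [|h Hh E] := rP (vorbit H v).
    by exists v; exact: (vorbit_refl grpH).
  exists h^-1; split; first exact: group_closedV.
  by rewrite E vactK.
pose s v := r (vorbit H v).
have sact v h : h \in H -> s (vact v h) = s v.
  by move=> Hh; rewrite /s vorbit_act.
have kact v h : h \in H -> trivial H v -> k (vact v h) = k v * h.
  move=> Hh tv; have [Hk vk] := kP v; have [Hk' vk'] := kP (vact v h).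
  have Hkh : k v * h \in H by exact: group_closedM.
  have : k (vact v h) * h^-1 * (k v)^-1 = 1.
    have HV := group_closedV grpH; have HM := group_closedM grpH.
    have svE : vact v (k v)^-1 = s v by rewrite -[RHS](vactK _ (k v)) -vk.
    apply: (trivialP (v := s v)); last first.
    - by rewrite !vactM -(sact v h Hh) -[vact (s _) _]vk' vactK svE sact.
    - by apply: (HM); [apply: (HM) => //|]; apply: (HV).
    - by rewrite -svE; apply: trivial_act => //; exact: HV.
  move=> /divg1_eq E; apply: (mulIg h^-1).
  by rewrite mulgK.
exists (fun x y => (s x <> s y /\ R (s x) (s y)) \/
  (s x = s y /\ leG (k x) (k y))); split.
- move=> x y z [[xy Rxy]|[xy kxy]] [[yz Ryz]|[yz kyz]].
  + left; split; last exact: Rtrans Rxy Ryz.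
    by move=> xz; apply: xy; apply: Ranti; rewrite Rxy xz.
  + by left; rewrite -yz.
  + by left; rewrite xy.
  + by right; rewrite xy yz; split=> //; exact: leG_trans kxy kyz.
- move=> x y; have [xy|xy] := pselect (s x = s y).
    by case/orP: (leG_total (k x) (k y)); [left|right]; right.
  case/orP: (Rtot (s x) (s y)); [left|right]; left; split=> //.
  exact: nesym.
- move=> x y [[xy Rxy]|[xy kxy]] [[yx Ryx]|[yx kyx]].
  + by case: xy; apply: Ranti; rewrite Rxy.
  + by case: xy.
  + by case: yx.
  + have [_ ->] := kP x; have [_ ->] := kP y; rewrite -!/(s _) xy.
    by rewrite (leG_anti (k x) (k y))// kxy.
- move=> x y h Hh tx ty; rewrite !sact// !kact//.
  by case=> [|[xy kxy]]; [left|right; split=> //; exact: leG_inv].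
Qed.

End VertexOrder.

(** * Kruskal's algorithm *)

Section Kruskal.
Variables (G : groupType) (T : gtree G).
Hypothesis stabT : trivial_edge_stabilisers T.
Variable H : {pred G}.
Hypothesis grpH : group_closed H.
Variable le : edge T -> edge T -> Prop.
Hypothesis le_trans : forall x y z, le x y -> le y z -> le x z.
Hypothesis le_total : forall x y, le x y \/ le y x.
Hypothesis le_anti : forall x y, le x y -> le y x -> x = y.
Hypothesis le_act : forall x y g, le x y -> le (eact x g) (eact y g).
Variable P : set (edge T).
Hypothesis P_act : forall e h, h \in H -> P e -> P (eact e h).
Hypothesis finP : finite_set (eorbit H @` P).
Variable vle : vertex T -> vertex T -> Prop.
Hypothesis vle_trans : forall x y z, vle x y -> vle y z -> vle x z.
Hypothesis vle_total : forall x y, vle x y \/ vle y x.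
Hypothesis vle_anti : forall x y, vle x y -> vle y x -> x = y.
Hypothesis vle_act : forall x y h, h \in H -> trivial H x -> trivial H y ->
  vle x y -> vle (vact x h) (vact y h).
Implicit Types (u v w x y z : vertex T) (e f : edge T) (h k : G).

Local Notation below := (below le P).
Local Notation cluster := (cluster le P).
Local Notation dead := (dead H le P).

Let HV h : h \in H -> h^-1 \in H. Proof. exact: group_closedV. Qed.
Let le_refl e : le e e. Proof. by case: (le_total e e). Qed.
Let vle_refl v : vle v v. Proof. by case: (vle_total v v). Qed.

Definition is_root e u v := cluster e u v /\ forall x, cluster e u x -> vle v x.

(* Adding [e] to the forest of smaller edges merges the clusters of its ends.
   The root of a dead cluster is its [vle]-smallest vertex: [e] kills the
   larger of the roots it merges, and the other one survives. *)
Definition kills e v := P e /\ exists u,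
  [/\ ends e u, dead e u, is_root e u v &
      forall w v', ends e w -> dead e w -> is_root e w v' -> vle v' v].

Definition survives e v := P e /\ exists u w,
  [/\ ends e = [set u; w], dead e u, dead e w, is_root e u v &
      forall v', is_root e w v' -> vle v v'].

Lemma cluster_refl e u : cluster e u u.
Proof. exact: joined_refl. Qed.

Lemma root_exists e u : dead e u -> exists v, is_root e u v.
Proof.
move=> [fin _]; have [|v cv vmin] := finite_min vle_trans vle_total fin.
  by exists u; exact: cluster_refl.
by exists v.
Qed.

Lemma root_uniq e u v v' : is_root e u v -> is_root e u v' -> v = v'.
Proof. by move=> [cv vm] [cv' vm']; apply: vle_anti; [exact: vm|exact: vm']. Qed.

Lemma root_trivial e u v : dead e u -> is_root e u v -> trivial H v.
Proof. by move=> [_ triv] [/triv]. Qed.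

Lemma root_act e u v h : h \in H -> dead e u -> is_root e u v ->
  is_root (eact e h) (vact u h) (vact v h).
Proof.
move=> Hh de rv; have [cv vm] := rv.
split; first exact: (cluster_act le_act P_act Hh cv).
move=> x /(cluster_actV grpH le_act P_act Hh) cx.
rewrite -[x](vactVK x h); apply: vle_act => //; last exact: vm.
  exact: root_trivial rv.
by case: de => _; exact.
Qed.

Lemma root_actV e u v h : h \in H -> dead e u ->
  is_root (eact e h) (vact u h) v -> is_root e u (vact v h^-1).
Proof.
move=> Hh /(dead_act grpH le_act P_act Hh) de.
by move=> /(root_act (HV Hh) de); rewrite eactK vactK.
Qed.

Lemma kills_act e v h : h \in H -> kills e v -> kills (eact e h) (vact v h).
Proof.
move=> Hh [Pe [u [eu de rv vm]]]; split; first exact: P_act.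
exists (vact u h); split.
- exact: ends_act_in.
- exact: (dead_act grpH le_act P_act).
- exact: root_act.
move=> w v' ew dw rv'; rewrite -[v'](vactVK v' h).
have ew' : ends e (vact w h^-1).
  by have := ends_act_in h^-1 ew; rewrite eactK.
have dw' : dead e (vact w h^-1).
  by apply: (dead_actV grpH le_act P_act Hh); rewrite vactVK.
have rv2 : is_root e (vact w h^-1) (vact v' h^-1).
  by apply: root_actV => //; rewrite vactVK.
apply: vle_act => //; [exact: root_trivial rv2|exact: root_trivial rv|].
exact: vm rv2.
Qed.

Lemma survives_act e v h :
  h \in H -> survives e v -> survives (eact e h) (vact v h).
Proof.
move=> Hh [Pe [u [w [uw du dw rv vm]]]]; split; first exact: P_act.
exists (vact u h), (vact w h); split.
- exact: ends_act.
- exact: (dead_act grpH le_act P_act).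
- exact: (dead_act grpH le_act P_act).
- exact: root_act.
move=> v' rv'; rewrite -[v'](vactVK v' h).
have rv2 : is_root e w (vact v' h^-1) by exact: root_actV.
apply: vle_act => //; [exact: root_trivial rv|exact: root_trivial rv2|].
exact: vm.
Qed.

(** The vertex killed is the larger of the two roots if both clusters are dead, and the only root
    otherwise. *)
Lemma kills_exists e u : P e -> ends e u -> dead e u -> exists v, kills e v.
Proof.
move=> Pe eu du; have [w uw] := other_end eu.
have [v rv] := root_exists du.
have [[v' [dw rv' vv']]|nv'] := pselect (exists v',
    [/\ dead e w, is_root e w v' & ~ vle v' v]).
  exists v'; split=> //; exists w; split=> //; first by rewrite uw; right.
  have {}vv' : vle v v' by case: (vle_total v v').
  move=> x v2; rewrite uw => -[-> _|-> _] r2.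
    by rewrite (root_uniq r2 rv).
  by rewrite (root_uniq r2 rv').
exists v; split=> //; exists u; split=> // x v2; rewrite uw => -[->|->] d2 r2.
  by rewrite (root_uniq r2 rv).
by apply: contrapT => nv2; apply: nv'; exists v2.
Qed.

Lemma kills_fun e v v' : kills e v -> kills e v' -> v = v'.
Proof.
move=> [_ [u [eu du rv vm]]] [_ [w [ew dw rv' vm']]].
by apply: vle_anti; [exact: vm' rv|exact: vm rv'].
Qed.

Lemma survives_fun e v v' : survives e v -> survives e v' -> v = v'.
Proof.
move=> [_ [u [w [uw du dw rv vm]]]] [_ [u' [w' [uw' du' dw' rv' vm']]]].
move: uw; rewrite uw' => uw.
have [[? ?]|[? ?]] := set2_eq uw; subst u' w'; first exact: root_uniq rv rv'.
by apply: vle_anti; [exact: vm|exact: vm'].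
Qed.

Lemma kills_trivial e v : kills e v -> trivial H v.
Proof. by move=> [_ [u [_ du rv _]]]; exact: root_trivial rv. Qed.

Lemma kills_closed (Z : set (vertex T)) e v :
  (forall f, P f -> ends f `<=` Z) -> kills e v -> Z v.
Proof.
move=> PZ [Pe [u [eu _ [cv _] _]]].
apply: joined_closed cv; last exact: PZ eu.
by move=> f x y [Pf _ _] xy _; apply: (PZ f) => //; rewrite xy; right.
Qed.

Lemma below_below e e' : le e e' -> e <> e' -> below e `<=` below e'.
Proof.
move=> ee' ne f [Pf fe nfe]; split=> //; first exact: le_trans ee'.
by move=> fe'; subst f; apply: ne; exact: le_anti.
Qed.

Lemma cluster_disjoint e u w x :
  ends e = [set u; w] -> cluster e u x -> ~ cluster e w x.
Proof.
move=> uw cu /joined_sym cw.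
apply: (acyclic_sep (gtree_acyclic (T := T)) _ _ _ uw (joined_trans cu cw)) => //.
by case.
Qed.

(** Let [e] be smaller than [e']. The dead cluster with root [v] at [e'] contains both clusters at
    [e]. So the cluster of [w] at [e] is dead too; its root is at most [v] as [e] kills [v], and at
    least [v] by minimality at [e']. But the clusters at the two ends of [e] are disjoint. *)
Lemma kills_inj e e' v : kills e v -> kills e' v -> e = e'.
Proof.
wlog ee' : e e' / le e e'.
  by move=> W k k'; have [/W->|/W->] := le_total e e'.
move=> [Pe [u [eu du [cv vm] km]]] [_ [u' [eu' [fin' triv'] [cv' vm'] _]]].
apply: contrapT => ne; have sub := below_below ee' ne.
have [w uw] := other_end eu.
have ew : ends e w by rewrite uw; right.
have u'w : joined (below e') u' w.
  apply: joined_trans cv' _.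
  apply: (joined_trans (joined_sub sub (joined_sym cv))).
  by apply: joined_edge uw; split.
have cw : cluster e w `<=` cluster e' u'.
  by move=> x /(joined_sub sub)/(joined_trans u'w).
have dw : dead e w.
  by split; [exact: sub_finite_set fin'|exact: subset_trans triv'].
have [v2 r2] := root_exists dw.
have v2v := km _ _ ew dw r2.
have vv2 : vle v v2 by apply: vm'; apply: cw; case: r2.
have E := vle_anti v2v vv2; subst v2.
by case: r2 => cwv _; exact: cluster_disjoint uw cv cwv.
Qed.

(** At most one edge per orbit: if [v] survives both an edge and its translate by [h], then [h]
    fixes [v], so it is trivial. *)
Lemma finite_survives v : trivial H v -> finite_set [set e | survives e v].
Proof.
move=> tv.
suff : finite_set (id @` [set e | survives e v]) by rewrite image_id.
apply: (finite_image_fibers (f := eorbit H)).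
  by apply: sub_finite_set finP => _ [f [Pf _] <-]; exists f.
move=> f sf; apply: (sub_finite_set (B := [set f])); last exact: finite_set1.
move=> _ [f' [sf' /esym/(eorbit_eq grpH)[h Hh E]] <-]; subst f'.
have vh := survives_fun sf' (survives_act Hh sf).
by rewrite /= (trivialP tv Hh (esym vh)) eact1.
Qed.

(* If [v] is never killed, the smallest edge leaving the cluster grown from [v]
   by the last edge that [v] survives kills [v] or is also survived. *)
Lemma kills_surj v : trivial H v -> infinite_set [set x | joined P v x] ->
  exists e, kills e v.
Proof.
move=> tv vinf.
(* The component [D] of [v] in [L] is the cluster grown from [v] up to and including the last edge
   that [v] survives, or [v] alone if there is none. *)
pose L := [set f | P f /\ exists2 b, survives b v & le f b].
pose D := [set x | joined L v x].
have [Dfin Dtriv Dmin] : [/\ finite_set D, D `<=` trivial H &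
    forall x, D x -> vle v x].
  have [sne|nos] := pselect ([set e | survives e v] !=set0); last first.
    have D1 : D `<=` [set v].
      move=> x; apply: joined_closed => // f y z [_ [b sb _]].
      by case: nos; exists b.
    by split=> [||x /D1->]//; [exact: sub_finite_set (finite_set1 v)|move=> x /D1->].
  (* The reversed order yields the largest of the finitely many edges that [v] survives. *)
  have [||b sb bmax] :=
    @finite_min _ (fun f f' => le f' f) _ _ _ (finite_survives tv) sne.
  - by move=> x y z yx zy; exact: le_trans zy yx.
  - by move=> x y; case: (le_total x y); [right|left].
  have [Pb [u [w [uw du dw rv vm]]]] := sb.
  have Dsub : D `<=` cluster b u `|` cluster b w.
    move=> x; apply: joined_closed; last by left; case: rv.
    move=> f y z [Pf [b' /bmax b'b fb']] yz.
    have fb : le f b by exact: le_trans b'b.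
    have [ne|ne] := pselect (f = b).
      subst f; move: yz; rewrite uw => yz _.
      by have [[_ <-]|[<- _]] := set2_eq yz; [right|left]; exact: cluster_refl.
    have fz : joined (below b) y z by apply: joined_edge yz.
    by case=> c; [left|right]; exact: joined_trans c fz.
  have cfin : finite_set (cluster b u `|` cluster b w).
    by rewrite finite_setU; split; [case: du|case: dw].
  split; first exact: sub_finite_set cfin.
    by move=> x /Dsub[]; [case: du => _|case: dw => _]; exact.
  move=> x /Dsub[cx|cx]; first by case: rv => _; exact.
  have [v' rv'] := root_exists dw.
  by apply: vle_trans (vm _ rv') _; case: rv' => _; exact.
(* The candidates for leaving [D]: finitely many because [D] is finite with trivial stabilisers, and
   at least one because the component of [v] is infinite. *)
pose B := [set f | [/\ P f, ~ L f & exists2 x, D x & ends f x]].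
have Bfin : finite_set B.
  have sub : B `<=` \bigcup_(x in D) [set f | P f /\ ends f x].
    by move=> f [Pf _ [x Dx fx]]; exists x.
  apply: sub_finite_set sub _; apply: bigcup_finite => // x Dx.
  by apply: (finite_edges_at grpH finP); exact: Dtriv.
have Bne : B !=set0.
  apply: contrapT => B0; apply: vinf; apply: sub_finite_set Dfin => x.
  apply: joined_closed; last exact: joined_refl.
  move=> f y z Pf yz Dy; have [Lf|nLf] := pselect (L f).
    exact: joined_trans Dy (joined_edge Lf yz).
  by case: B0; exists f; split=> //; exists y => //; rewrite yz; left.
have [e [Pe nLe [u Du eu]] emin] := finite_min le_trans le_total Bfin Bne.
have LB : L `<=` below e.
  move=> f Lf; have [Pf [b sb fb]] := Lf; split=> //; last first.
    by move=> fe; apply: nLe; rewrite -fe.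
  apply: le_trans fb _; have [//|eb] := le_total b e.
  by case: nLe; split=> //; exists b.
have cD : cluster e u `<=` D.
  move=> x; apply: joined_closed => // f y z [Pf fe nfe] yz Dy.
  have [Lf|nLf] := pselect (L f).
    exact: joined_trans Dy (joined_edge Lf yz).
  case: nfe; apply: le_anti => //; apply: emin; split=> //.
  by exists y => //; rewrite yz; left.
have du : dead e u by split; [exact: sub_finite_set Dfin|exact: subset_trans Dtriv].
have rv : is_root e u v.
  split; last by move=> x /cD/Dmin.
  by apply: joined_sym; exact: joined_sub Du.
have [w uw] := other_end eu.
(* If the cluster on the other side is dead with a larger root, then [v] survives [e], which puts
   [e] in [L]; otherwise [e] kills [v]. *)
have [[v' [dw rv' nv']]|nv'] := pselect (exists v',
    [/\ dead e w, is_root e w v' & ~ vle v' v]).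
  case: nLe; split=> //; exists e => //; split=> //; exists u, w; split=> // v2 r2.
  by rewrite (root_uniq r2 rv'); case: (vle_total v v').
exists e; split=> //; exists u; split=> // x v2; rewrite uw => -[->|->] dx r2.
  by rewrite (root_uniq r2 rv).
by apply: contrapT => nv2; apply: nv'; exists v2.
Qed.

End Kruskal.

(** * Counting bridges *)

(** The hypothesis makes [Q] a property of the fibres of [f], so the two images are disjoint. *)
Lemma card_image_split X Y (f : X -> Y) (A Q : set X) n :
  (forall a b, f a = f b -> Q a -> Q b) -> (f @` A #= `I_n)%card ->
  exists m k, [/\ (f @` (A `&` Q) #= `I_m)%card,
    (f @` (A `\` Q) #= `I_k)%card & n = (m + k)%N].
Proof.
move=> Qf An.
have fA : finite_set (f @` A) by apply/finite_setP; exists n.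
have /finite_setP[m Am] : finite_set (f @` (A `&` Q)).
  by apply: sub_finite_set fA => _ [a [Aa _] <-]; exists a.
have /finite_setP[k Ak] : finite_set (f @` (A `\` Q)).
  by apply: sub_finite_set fA => _ [a [Aa _] <-]; exists a.
exists m, k; split=> //; apply: card_II_uniq An _.
have -> : f @` A = f @` (A `&` Q) `|` f @` (A `\` Q).
  by rewrite -image_setU setUIDK.
apply: card_setU_disj => //; apply/seteqP; split=> // y [[a [_ Qa] <-]].
by move=> [b [_ nQb] /esym/Qf]; move=> /(_ Qa).
Qed.

Section Count.
Variables (G : groupType) (T : gtree G).
Hypothesis stabT : trivial_edge_stabilisers T.
Variable H : {pred G}.
Hypothesis grpH : group_closed H.
Variable le : edge T -> edge T -> Prop.
Hypothesis le_trans : forall x y z, le x y -> le y z -> le x z.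
Hypothesis le_total : forall x y, le x y \/ le y x.
Hypothesis le_anti : forall x y, le x y -> le y x -> x = y.
Hypothesis le_act : forall x y g, le x y -> le (eact x g) (eact y g).
Variable vle : vertex T -> vertex T -> Prop.
Hypothesis vle_trans : forall x y z, vle x y -> vle y z -> vle x z.
Hypothesis vle_total : forall x y, vle x y \/ vle y x.
Hypothesis vle_anti : forall x y, vle x y -> vle y x -> x = y.
Hypothesis vle_act : forall x y h, h \in H -> trivial H x -> trivial H y ->
  vle x y -> vle (vact x h) (vact y h).
Implicit Types (u v w x y z : vertex T) (e f : edge T) (h k : G).

(* A maximal subtree of T/H, rooted at the orbit of [o]: [A] is its preimage in
   T and [depth] the distance to the root. *)
Variables (A : set (edge T)) (depth : vertex T -> nat) (o : vertex T).
Hypothesis A_act : forall e h, h \in H -> A e -> A (eact e h).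
Hypothesis depth_act : forall v h, h \in H -> depth (vact v h) = depth v.
Hypothesis depth0 : forall v, depth v = 0%N -> vorbit H v = vorbit H o.
Hypothesis depth_o : depth o = 0%N.
Hypothesis depth_ends : forall e u v, A e -> ends e = [set u; v] ->
  depth u = (depth v).+1 \/ depth v = (depth u).+1.
Hypothesis parent : forall v, depth v <> 0%N -> exists e u,
  [/\ A e, ends e = [set v; u] & depth v = (depth u).+1].
Hypothesis parent_uniq : forall e f v v' u w, A e -> A f ->
  ends e = [set v; u] -> ends f = [set v'; w] -> vorbit H v = vorbit H v' ->
  depth v = (depth u).+1 -> depth v' = (depth w).+1 ->
  eorbit H e = eorbit H f.

(** [Z] and [F] are the preimages of the vertices of a finite subtree of T/H containing the root,
    and of finitely many further edges between them outside the maximal subtree. *)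
Variables (Z : set (vertex T)) (F : set (edge T)).
Hypothesis Z_act : forall v h, h \in H -> Z v -> Z (vact v h).
Hypothesis Z_fin : finite_set (vorbit H @` Z).
Hypothesis Z_o : Z o.
Hypothesis Z_parent : forall e v u, Z v -> A e -> ends e = [set v; u] ->
  depth v = (depth u).+1 -> Z u.
Hypothesis F_act : forall e h, h \in H -> F e -> F (eact e h).
Hypothesis F_fin : finite_set (eorbit H @` F).
Hypothesis FA : forall e, F e -> ~ A e.
Hypothesis FZ : forall e, F e -> ends e `<=` Z.

Definition tree_part := [set e | A e /\ ends e `<=` Z].
Definition core := F `|` tree_part.

Local Notation P := core.
Local Notation dead := (dead H le P).

Let HV h : h \in H -> h^-1 \in H. Proof. exact: group_closedV. Qed.
Let HM h k : h \in H -> k \in H -> h * k \in H.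
Proof. exact: group_closedM. Qed.

Lemma core_ends e : P e -> ends e `<=` Z.
Proof. by case=> [/FZ|[]]. Qed.

Lemma tree_part_act e h : h \in H -> tree_part e -> tree_part (eact e h).
Proof.
move=> Hh [Ae eZ]; split; first exact: A_act.
by rewrite ends_eact => _ [v /eZ Zv <-]; exact: Z_act.
Qed.

Lemma core_act e h : h \in H -> P e -> P (eact e h).
Proof.
by move=> Hh [Fe|te]; [left; exact: F_act|right; exact: tree_part_act].
Qed.

(** A finite tree has one edge fewer than vertices: apart from the root, each vertex orbit in [Z]
    matches the orbit of the edges to the parents. *)
Lemma card_tree_part n : (vorbit H @` Z #= `I_n)%card ->
  exists2 m, n = m.+1 & (eorbit H @` tree_part #= `I_m)%card.
Proof.
move=> Zn.
have sub a b : vorbit H a = vorbit H b -> depth a = 0%N -> depth b = 0%N.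
  by move=> /(vorbit_eq grpH)[h Hh ->]; rewrite depth_act.
have [k [m [Zk Zm ->]]] := card_image_split sub Zn.
have k1 : k = 1%N.
  apply: card_II_uniq Zk _.
  have -> : vorbit H @` (Z `&` (fun a => depth a = 0%N)) = [set vorbit H o].
    apply/seteqP; split=> [_ [v [_ /depth0 v0] <-]//|_ ->].
    by exists o.
  exact: card_set1.
exists m; first by rewrite k1.
apply: card_eq_trans Zm.
apply: (card_eq_rel (R := fun O Q => exists e v u,
  [/\ O = eorbit H e /\ Q = vorbit H v, A e, ends e = [set v; u] &
      depth v = (depth u).+1])).
- move=> _ [e [Ae eZ] <-]; have [a [b ab]] := endsP e.
  wlog dab : a b ab / depth a = (depth b).+1.
    move=> W; have [|dba] := depth_ends Ae ab; first exact: W.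
    by apply: (W b a) => //; rewrite setUC.
  exists (vorbit H a); last by exists e, a, b.
  exists a => //; split; first by apply: eZ; rewrite ab; left.
  by rewrite /= dab.
- move=> _ [v [Zv dv] <-]; have [e [u [Ae vu du]]] := parent dv.
  exists (eorbit H e); last by exists e, v, u.
  exists e => //; split=> //; rewrite vu => _ [->|->] //.
  exact: Z_parent Zv Ae vu du.
- move=> O O' Q _ _ [e [v [u [[-> Qv] Ae vu dv]]]].
  move=> [e' [v' [u' [[-> Qv'] Ae' vu' dv']]]].
  by apply: (parent_uniq Ae Ae' vu vu'); rewrite -?Qv -?Qv'.
- move=> O Q Q' _ _ [e [v [u [[Oe ->] Ae vu dv]]]].
  move=> [e' [v' [u' [[Oe' ->] Ae' vu' dv']]]].
  have := Oe'; rewrite Oe => /(eorbit_eq grpH)[h Hh e'h].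
  move: vu'; rewrite e'h (ends_act h vu) => E.
  have [[<- _]|[vh uh]] := set2_eq E; first by rewrite vorbit_act.
  by move: dv'; rewrite -uh -vh !depth_act// dv; lia.
Qed.

Lemma finite_core : finite_set (eorbit H @` P).
Proof.
have [n Zn] : exists n, (vorbit H @` Z #= `I_n)%card by apply/finite_setP.
have [m _ tm] := card_tree_part Zn.
by rewrite image_setU finite_setU; split=> //; apply/finite_setP; exists m.
Qed.

Lemma core_joined v : Z v -> exists2 h, h \in H & joined P v (vact o h).
Proof.
move Ed : (depth v) => d; elim: d v Ed => [|d IH] v Ed Zv.
  have [h Hh ->] := vorbit_eq grpH (esym (depth0 Ed)).
  by exists h => //; exact: joined_refl.
have [|e [u [Ae vu dv]]] := parent (v := v); first by rewrite Ed.
have Zu := Z_parent Zv Ae vu dv.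
have [|h Hh uo] := IH u _ Zu; first by move: dv; rewrite Ed => -[].
exists h => //; apply: joined_trans uo; apply: (joined_edge _ vu); right; split=> //.
by rewrite vu => _ [->|->].
Qed.

Lemma bridge_live e : P e ->
  bridge_in le P e <-> forall u, ends e u -> ~ dead e u.
Proof.
move=> Pe; split=> [b u eu du|live].
  exact: (dead_not_bridge eu du b).
have [u [v uv]] := endsP e.
by apply: (live_bridge stabT grpH le_trans le_total le_act core_act finite_core Pe uv);
  apply: live; rewrite uv; [left|right].
Qed.

(** The bridge yields a ray, with infinitely many vertices. Every vertex of [Z] is joined to a
    translate of [o], so a translate of the ray lies in the component of [v]. *)
Lemma infinite_component e v : P e -> bridge_in le P e -> Z v ->
  infinite_set [set x | joined P v x].
Proof.
move=> Pe b Zv fin; have [u [w uw]] := endsP e.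
have [[x [y [r _ x0 _ _]]] _] := bridge_halfrays b uw.
have Zu : Z u by apply: (core_ends Pe); rewrite uw; left.
have [h Hh vo] := core_joined Zv; have [k Hk uo] := core_joined Zu.
have Hg : k^-1 * h \in H by apply: HM => //; exact: HV.
have vu : joined P v (vact u (k^-1 * h)).
  apply: joined_trans vo _; apply: joined_sym.
  have := joined_act (F' := P) (g := k^-1 * h) _ uo.
  by rewrite -[X in joined P _ X]vactM mulVKg; apply=> f; exact: core_act.
have ac := @gtree_acyclic_sub G T P.
have [|i [j [_ ij]]] :=
    @finite_image_nat _ (fun i => vact (x i) (k^-1 * h)) 0.
  apply: sub_finite_set fin => _ [i _ <-]; apply: joined_trans vu _.
  apply: (joined_act (F := P)) => [f|]; first exact: core_act.
  by rewrite -x0; exists (segment x y 0 i);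
    [exact: is_path_segment|rewrite path_end_segment].
by move=> /vact_inj; exact: (ray_inj r).
Qed.

(** There are m + 1 = c + v0 orbits of vertices, v0 of them with trivial stabiliser, and r + m = nb
    + nn orbits of edges, nn of them not bridges. So the claim amounts to nn <= v0, with equality if
    0 < nb; [kills] induces the injection and its inverse. *)
Lemma count_bridges r c : (eorbit H @` F #= `I_r)%card ->
  (vorbit H @` [set v | Z v /\ nontrivial_stabiliser H v] #= `I_c)%card ->
  exists nb, [/\ (eorbit H @` [set e | P e /\ bridge_in le P e] #= `I_nb)%card,
    (r + c <= nb.+1)%N & (0 < nb)%N -> (r + c)%N = nb.+1].
Proof.
move=> Fr Nc.
have [n Zn] : exists n, (vorbit H @` Z #= `I_n)%card by apply/finite_setP.
have [m nm tm] := card_tree_part Zn.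
have Pn : (eorbit H @` P #= `I_(r + m))%card.
  rewrite image_setU; apply: card_setU_disj => //.
  apply/seteqP; split=> // O [[e Fe <-] [f [Af _] /esym/(eorbit_eq grpH)[h Hh E]]].
  by apply: (FA (F_act Hh Fe)); rewrite -E.
have nt_act (a b : vertex T) : vorbit H a = vorbit H b ->
    nontrivial_stabiliser H a -> nontrivial_stabiliser H b.
  move=> /(vorbit_eq grpH)[h Hh ->]; apply: contrapT => /not_implyP[nta].
  by move=> /(trivial_act grpH (HV Hh)); rewrite vactK; exact.
have [c' [v0 [Nc' Vv0 nE]]] := card_image_split nt_act Zn.
have cc' : c' = c by apply: card_II_uniq Nc' Nc.
pose live e := forall u, ends e u -> ~ dead e u.
have live_act (a b : edge T) : eorbit H a = eorbit H b -> live a -> live b.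
  move=> /(eorbit_eq grpH)[h Hh ->] la u.
  move=> /(ends_act_in h^-1); rewrite eactK => /la ndu du; apply: ndu.
  by apply: (dead_actV grpH le_act core_act Hh); rewrite vactVK.
have [nb [nn [NB NN E]]] := card_image_split live_act Pn.
have EB : [set e | P e /\ bridge_in le P e] = P `&` live.
  apply/seteqP; split=> e [Pe be]; split=> //; first exact/(bridge_live Pe).
  exact/(bridge_live Pe).
pose R (O : set (edge T)) (Q : set (vertex T)) := exists e v,
  [/\ O = eorbit H e, Q = vorbit H v & kills H le P vle e v].
have kact := kills_act grpH le_act core_act vle_act.
have Rtot O : (eorbit H @` (P `\` live)) O -> exists2 Q,
    (vorbit H @` (Z `\` nontrivial_stabiliser H)) Q & R O Q.
  move=> [e [Pe /existsNP[u /not_implyP[eu /contrapT du]]] <-].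
  have [v kv] := kills_exists vle_trans vle_total vle_anti Pe eu du.
  exists (vorbit H v); last by exists e, v.
  exists v => //; split; last exact: kills_trivial kv.
  exact: kills_closed core_ends kv.
have Rinj O O' Q : R O Q -> R O' Q -> O = O'.
  move=> [e [v [-> -> k]]] [e' [v' [-> /(vorbit_eq grpH)[h Hh vh] k']]].
  have := kact e v h Hh k; rewrite -vh => kh.
  by rewrite (kills_inj le_trans le_total le_anti vle_trans vle_total vle_anti k' kh)
    eorbit_act.
have nnv0 : (nn <= v0)%N.
  apply: card_II_le NN Vv0 _; apply: (card_le_rel (R := R)) => //.
  by move=> O O' Q _ _; exact: Rinj.
exists nb; rewrite EB; split=> //; first by lia.
move=> nb0; suff : (v0 <= nn)%N by lia.
have [e [Pe be]] : exists e, P e /\ bridge_in le P e.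
  apply: contrapT => nex; move: nb0 NB.
  have -> : P `&` live = set0.
    by apply/seteqP; split=> // e; rewrite -EB => ?; apply: nex; exists e.
  rewrite image_set0 => nb0 NB0; move: nb0.
  by rewrite (card_II_uniq NB0 (n := 0%N))// II0 card_eq00.
(* A bridge makes the component of each vertex of [Z] infinite, so [kills_surj] applies to those
   with trivial stabiliser. *)
apply: card_II_le Vv0 NN _; apply: (card_le_rel (R := fun Q O => R O Q)).
  move=> _ [v [Zv tv] <-].
  have [f kf] := kills_surj grpH le_trans le_total le_anti le_act core_act
    finite_core vle_trans vle_total vle_anti vle_act tv (infinite_component Pe be Zv).
  exists (eorbit H f); last by exists f, v.
  exists f => //; split; first by case: kf.
  by move=> lf; case: kf => _ [u [fu du _ _]]; exact: lf fu du.
move=> Q Q' O _ _ [e1 [v1 [-> -> k1]]] [e2 [v2 [/(eorbit_eq grpH)[h Hh eh] -> k2]]].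
have := kact _ _ h Hh k1; rewrite -eh => kh.
by rewrite (kills_fun vle_anti k2 kh) vorbit_act.
Qed.

End Count.

(** * The order on the edges and the quotient graph *)

Section EdgeOrder.
Variables (G : groupType) (T : gtree G).
Hypothesis stabT : trivial_edge_stabilisers T.
Variables (leG : rel G) (leO : rel (edge (quotient_by_G T))).
Variable rep : edge (quotient_by_G T) -> edge T.
Hypothesis leG_order : total_order leG.
Hypothesis leG_inv : right_invariant leG.
Hypothesis leO_order : total_order leO.
Hypothesis repP : representatives rep.
Implicit Types (e f : edge T) (g h : G).
Local Notation le := (edge_le leG leO rep).

Lemma coordinates e : exists O g, e = eact (rep O) g.
Proof.
have eO : eorbit predT e \in eorbits (T := T) predT by apply: mem_set; exists e.
pose O : edge (quotient_by_G T) := SigSub eO.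
have [g _ E] : eorbit predT e (rep O) by exact: (repP O).
by exists O, g^-1; rewrite E eactK.
Qed.

Lemma coordinates_uniq O O' g g' :
  eact (rep O) g = eact (rep O') g' -> O = O' /\ g = g'.
Proof.
move=> E.
have repE (Q : edge (quotient_by_G T)) k :
    val Q = eorbit predT (eact (rep Q) k).
  have [e _ Qe] : eorbits predT (val Q) := set_mem (valP Q).
  have := repP Q; rewrite -Qe => -[h Hh ->].
  by rewrite -eactM eorbit_act.
have OO' : O = O' by apply: val_inj; rewrite (repE O g) E -repE.
by subst O'; split=> //; exact: eact_free E.
Qed.

Lemma edge_le_total e f : le e f \/ le f e.
Proof.
have [_ _ _ leG_total] := leG_order; have [_ _ _ leO_total] := leO_order.
have [O [g ->]] := coordinates e; have [Q [h ->]] := coordinates f.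
have [OQ|OQ] := pselect (O = Q).
  subst Q; case/orP: (leG_total g h) => gh.
    by left; exists O, g, O, h; split=> //; right.
  by right; exists O, h, O, g; split=> //; right.
case/orP: (leO_total O Q) => le; [left; exists O, g, Q, h|right; exists Q, h, O, g];
  split=> //; left; split=> //; exact: nesym.
Qed.

Lemma edge_le_trans e f k : le e f -> le f k -> le e k.
Proof.
have [_ _ leG_trans _] := leG_order; have [_ leO_anti leO_trans _] := leO_order.
move=> [O [g [Q [h [-> -> c]]]]] [Q' [h' [R [i [E -> c']]]]].
have [? ?] := coordinates_uniq E; subst Q' h'.
exists O, g, R, i; split=> //.
case: c c' => [[OQ lOQ]|[? gh]] [[QR lQR]|[? hi]]; subst.
- left; split; last exact: leO_trans lOQ lQR.
  by move=> OR; apply: OQ; apply: leO_anti; rewrite lOQ OR.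
- by left.
- by left.
- by right; split=> //; exact: leG_trans gh hi.
Qed.

Lemma edge_le_anti e f : le e f -> le f e -> e = f.
Proof.
have [_ leG_anti _ _] := leG_order; have [_ leO_anti _ _] := leO_order.
move=> [O [g [Q [h [-> -> c]]]]] [Q' [h' [O' [g' [E E' c']]]]].
have [? ?] := coordinates_uniq E; have [? ?] := coordinates_uniq E'.
subst Q' h' O' g'.
case: c c' => [[OQ lOQ]|[? gh]] [[QO lQO]|[? hg]]; subst => //.
  by case: OQ; apply: leO_anti; rewrite lOQ.
by rewrite (leG_anti g h)// gh.
Qed.

Lemma edge_le_act e f k : le e f -> le (eact e k) (eact f k).
Proof.
move=> [O [g [Q [h [-> -> c]]]]]; exists O, (g * k), Q, (h * k).
rewrite !eactM; split=> //; case: c => [|[OQ gh]]; [by left|right].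
by split=> //; exact: leG_inv.
Qed.

End EdgeOrder.

(** * Projection of T onto T/H *)

Section Quotient.
Variables (G : groupType) (T : gtree G) (H : {pred G}).
Hypothesis grpH : group_closed H.
Implicit Types (u v w : vertex T) (e f : edge T).
Local Notation Q := (quotient_graph T grpH).

Lemma vorbit_in v : vorbit H v \in vorbits (T := T) H.
Proof. by apply: mem_set; exists v. Qed.

Lemma eorbit_in e : eorbit H e \in eorbits (T := T) H.
Proof. by apply: mem_set; exists e. Qed.

Definition vproj v : vertex Q := SigSub (vorbit_in v).
Definition eproj e : edge Q := SigSub (eorbit_in e).

Lemma vproj_eq u v : vproj u = vproj v <-> vorbit H u = vorbit H v.
Proof.
split=> [E|E]; last exact: val_inj.
by rewrite -[LHS]/(val (vproj u)) E.
Qed.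

Lemma eproj_eq e f : eproj e = eproj f <-> eorbit H e = eorbit H f.
Proof.
split=> [E|E]; last exact: val_inj.
by rewrite -[LHS]/(val (eproj e)) E.
Qed.

Lemma vproj_surj (X : vertex Q) : exists v, X = vproj v.
Proof.
have [v _ E] : vorbits H (val X) := set_mem (valP X).
by exists v; apply: val_inj.
Qed.

Lemma eproj_surj (X : edge Q) : exists e, X = eproj e.
Proof.
have [e _ E] : eorbits H (val X) := set_mem (valP X).
by exists e; apply: val_inj.
Qed.

Lemma ends_eproj e u v :
  ends e = [set u; v] -> ends (eproj e) = [set vproj u; vproj v].
Proof.
move=> uv; apply/seteqP; split=> X.
  move=> [f [w [[h Hh ->] fw Xw]]]; move: fw; rewrite (ends_act h uv).
  by move=> [wE|wE]; [left|right]; apply: val_inj; rewrite Xw wE vorbit_act.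
have ee : val (eproj e) e by exact: eorbit_refl.
by move=> [->|->]; [exists e, u|exists e, v]; split=> //; rewrite uv;
  [left|right].
Qed.

Lemma quotient_joined (X Y : vertex Q) : joined setT X Y.
Proof.
have [u ->] := vproj_surj X; have [v ->] := vproj_surj Y.
have [p pp <-] := gtree_joined u v.
elim: p u pp => [|[e w] p IH] u /=; first by move=> _; exact: joined_refl.
move=> [_ uw pp]; rewrite path_end_cons; apply: joined_trans (IH w pp).
by apply: joined_edge (ends_eproj uw).
Qed.

(** Exposes the maximal subtree that [rank] picks, so that the later constructions can be based on
    the same one. *)
Lemma rank_maximal_subtree : exists S : subgraph Q,
  maximal_subtree S /\ rank Q = ecard (~` eset S).
Proof.
have [[v _] _ _] := gtree_tree T.
have exS := maximal_subtree_exists quotient_joined (vproj v).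
rewrite /rank; case: pselect => // exS'.
by exists (projT1 (cid exS')); split=> //; exact: (projT2 (cid exS')).
Qed.

End Quotient.

Lemma ecard_eq X Y (A : set X) (B : set Y) : (A #= B)%card -> ecard A = ecard B.
Proof.
move=> AB; have [|infB] := pselect (finite_set B).
  move=> /finite_setP[n Bn]; rewrite (ecardP Bn); apply: ecardP.
  exact: card_eq_trans Bn.
rewrite !ecard_infinite// => /finite_setP[n An]; apply: infB.
by apply/finite_setP; exists n; apply: card_eq_trans An; rewrite card_eq_sym.
Qed.

(** * Finite subgraphs of the quotient *)

Section Closure.
Variables (G : groupType) (T : gtree G).
Hypothesis stabT : trivial_edge_stabilisers T.
Variable H : {pred G}.
Hypothesis grpH : group_closed H.
Variable le : edge T -> edge T -> Prop.
Hypothesis le_trans : forall x y z, le x y -> le y z -> le x z.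
Hypothesis le_total : forall x y, le x y \/ le y x.
Hypothesis le_anti : forall x y, le x y -> le y x -> x = y.
Hypothesis le_act : forall x y g, le x y -> le (eact x g) (eact y g).
Variable vle : vertex T -> vertex T -> Prop.
Hypothesis vle_trans : forall x y z, vle x y -> vle y z -> vle x z.
Hypothesis vle_total : forall x y, vle x y \/ vle y x.
Hypothesis vle_anti : forall x y, vle x y -> vle y x -> x = y.
Hypothesis vle_act : forall x y h, h \in H -> trivial H x -> trivial H y ->
  vle x y -> vle (vact x h) (vact y h).
Implicit Types (u v w x y z : vertex T) (e f : edge T) (h k : G).
Implicit Types (p q : seq (edge T * vertex T)).

Variables (A : set (edge T)) (depth : vertex T -> nat) (o : vertex T).
Hypothesis A_act : forall e h, h \in H -> A e -> A (eact e h).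
Hypothesis depth_act : forall v h, h \in H -> depth (vact v h) = depth v.
Hypothesis depth0 : forall v, depth v = 0%N -> vorbit H v = vorbit H o.
Hypothesis depth_o : depth o = 0%N.
Hypothesis depth_ends : forall e u v, A e -> ends e = [set u; v] ->
  depth u = (depth v).+1 \/ depth v = (depth u).+1.
Hypothesis parent : forall v, depth v <> 0%N -> exists e u,
  [/\ A e, ends e = [set v; u] & depth v = (depth u).+1].
Hypothesis parent_uniq : forall e f v v' u w, A e -> A f ->
  ends e = [set v; u] -> ends f = [set v'; w] -> vorbit H v = vorbit H v' ->
  depth v = (depth u).+1 -> depth v' = (depth w).+1 ->
  eorbit H e = eorbit H f.

Let HV h : h \in H -> h^-1 \in H. Proof. exact: group_closedV. Qed.

(** Preimages of finite sets of vertices of T/H that contain, with each vertex, its path to the root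
    in the maximal subtree. *)
Definition ancestral (Z : set (vertex T)) :=
  [/\ forall v h, h \in H -> Z v -> Z (vact v h),
      finite_set (vorbit H @` Z) &
      forall e v u, Z v -> A e -> ends e = [set v; u] ->
        depth v = (depth u).+1 -> Z u].

(** Induction on the depth: add the orbit of [v] to an ancestral set containing a parent of [v]. *)
Lemma ancestral_vertex v : exists2 Z, ancestral Z & Z v.
Proof.
have orb_act v' w h : h \in H -> vorbit H v' w -> vorbit H v' (vact w h).
  by move=> Hh [k Hk ->]; exists (k * h); [exact: group_closedM|rewrite vactM].
have orb_fin v' (S : set (vertex T)) : finite_set (vorbit H @` S) ->
    finite_set (vorbit H @` (S `|` vorbit H v')).
  move=> fS; rewrite image_setU finite_setU; split=> //.
  apply: (sub_finite_set (B := [set vorbit H v'])); last exact: finite_set1.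
  by move=> _ [_ [h Hh ->] <-]; rewrite vorbit_act.
have depth_orb v' w : vorbit H v' w -> depth w = depth v'.
  by move=> [h Hh ->]; rewrite depth_act.
move Ed : (depth v) => d; elim: d v Ed => [|d IH] v Ed.
  exists (set0 `|` vorbit H v); last by right; exact: vorbit_refl.
  split=> [w h Hh [//|vw]||e w u [//|/depth_orb]].
  - by right; exact: orb_act.
  - by apply: orb_fin; rewrite image_set0; exact: finite_set0.
  - by rewrite Ed => -> _ _.
have [|e [u [Ae vu dv]]] := parent (v := v); first by rewrite Ed.
have [|Z [Zact Zfin Zpar] Zu] := IH u; first by move: dv; rewrite Ed => -[].
exists (Z `|` vorbit H v); last by right; exact: vorbit_refl.
split=> [w h Hh [Zw|vw]||f w x [Zw|vw]].
- by left; exact: Zact.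
- by right; exact: orb_act.
- exact: orb_fin.
- by move=> Af wx dw; left; exact: Zpar Zw Af wx dw.
(* A parent [x] of a translate of [v] is a translate of [u]: the two edges lie in one orbit, and
   matching their ends crosswise contradicts the depths. *)
move=> Af wx dw; left; case: vw wx dw => h Hh -> wx dw.
have /(eorbit_eq grpH)[k Hk E] : eorbit H e = eorbit H f.
  by apply: (parent_uniq Ae Af vu wx) => //; rewrite vorbit_act.
move: wx; rewrite E (ends_act k vu) => E'.
have [[_ <-]|[vx ux]] := set2_eq E'; first exact: Zact.
by move: dw; rewrite -ux -vx !depth_act// dv; lia.
Qed.

Lemma ancestral_hull (W : set (set (vertex T))) : finite_set W ->
  exists2 Z, ancestral Z & forall v, W (vorbit H v) -> Z v.
Proof.
move=> finW.
have /choice[S SP] : forall Q : set (vertex T), exists S,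
    ancestral S /\ forall v, vorbit H v = Q -> S v.
  move=> Q; have [[v vQ]|nQ] := pselect (exists v, vorbit H v = Q).
    have [S anS Sv] := ancestral_vertex v; exists S; split=> // w wQ.
    have [h Hh ->] := vorbit_eq grpH (etrans vQ (esym wQ)).
    by case: anS => Sact _ _; exact: Sact.
  exists set0; split; last by move=> v vQ; apply: nQ; exists v.
  by split=> //; rewrite image_set0; exact: finite_set0.
exists (\bigcup_(Q in W) S Q); last first.
  by move=> v Wv; exists (vorbit H v) => //; have [_] := SP (vorbit H v); exact.
split.
- move=> v h Hh [Q WQ Sv]; exists Q => //.
  by have [[Sact _ _] _] := SP Q; exact: Sact.
- rewrite image_bigcup; apply: bigcup_finite => // Q _.
  by have [[]] := SP Q.
- move=> e v u [Q WQ Sv] Ae vu dv; exists Q => //.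
  by have [[_ _ Spar] _] := SP Q; exact: Spar Sv Ae vu dv.
Qed.

(** By [line_minimal_subtree], a reduced line in [P] lies in the minimal subtree. *)
Lemma bridge_in_minimal Z F e :
  let P := core A Z F in finite_set (eorbit H @` P) ->
  P e -> bridge_in le P e -> bridges le H e.
Proof.
move=> P finP Pe [vs [es [r [i ei] emax]]].
have sub j : eset (minimal_subtree T H) (es j).
  exact: (line_minimal_subtree stabT grpH j finP r).
split; first by rewrite -ei; exact: sub.
exists vs, es; split=> // [j|]; last by exists i.
by have [_ E N] := r j; split.
Qed.

(** Applies [count_bridges] to a core containing given finite sets of orbits. The hull may pick up
    further vertices with non-trivial stabiliser, whence [c'] besides [c]. *)
Lemma bridges_ge (R : set (set (edge T))) (C : set (set (vertex T))) r c :
  R `<=` eorbit H @` (~` A) ->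
  C `<=` vorbit H @` [set v | nontrivial_stabiliser H v] ->
  (R #= `I_r)%card -> (C #= `I_c)%card ->
  exists Z F nb, let P := core A Z F in
  [/\ ancestral Z, forall v, C (vorbit H v) -> Z v,
      F = [set e | R (eorbit H e)] /\ finite_set (eorbit H @` P),
      forall e, F e -> ends e `<=` Z &
      (eorbit H @` [set e | P e /\ bridge_in le P e] #= `I_nb)%card /\
      exists2 c', (vorbit H @` [set v | Z v /\ nontrivial_stabiliser H v]
                    #= `I_c')%card /\ (c <= c')%N &
        (r + c' <= nb.+1)%N /\ ((0 < nb)%N -> (r + c')%N = nb.+1)].
Proof.
move=> Rsub Csub Rr Cc.
pose F := [set e | R (eorbit H e)].
have F_act e h : h \in H -> F e -> F (eact e h).
  by move=> Hh; rewrite /F /= eorbit_act.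
have FA e : F e -> ~ A e.
  move=> /Rsub[f nAf /(eorbit_eq grpH)[h Hh ->]] /(A_act (HV Hh)).
  by rewrite eactK.
have FR : eorbit H @` F = R.
  apply/seteqP; split=> [_ [e Fe <-]//|O RO].
  by have [e _ eO] := Rsub O RO; exists e => //; rewrite /F /= eO.
have Rfin : finite_set R by apply/finite_setP; exists r.
have Cfin : finite_set C by apply/finite_setP; exists c.
(* What the hull has to contain: the root, the orbits in [C] and the ends of the edges in [F]. *)
pose W := [set vorbit H o] `|` C `|` vorbit H @` [set v | exists2 e, F e & ends e v].
have Wfin : finite_set W.
  rewrite !finite_setU; split; first by split=> //; exact: finite_set1.
  have sub : vorbit H @` [set v | exists2 e, F e & ends e v] `<=`
      \bigcup_(O in R) (vorbit H @` [set v | exists2 e, eorbit H e = O & ends e v]).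
    move=> _ [v [e Fe ev] <-]; exists (eorbit H e) => //.
    by exists v => //; exists e.
  apply: sub_finite_set sub _; apply: bigcup_finite => // O RO.
  have [e _ eO] := Rsub O RO; have [a [b ab]] := endsP e.
  apply: (sub_finite_set (B := [set vorbit H a; vorbit H b])).
    move=> _ [v [f fO fv] <-]; move: fv.
    have [h Hh ->] := eorbit_eq grpH (etrans eO (esym fO)).
    by rewrite (ends_act h ab) => -[->|->]; rewrite vorbit_act//; [left|right].
  exact: finite_set2.
have [Z [Zact Zfin Zpar] ZW] := ancestral_hull Wfin.
have Zo : Z o by apply: ZW; left; left.
have ZC v : C (vorbit H v) -> Z v by move=> Cv; apply: ZW; left; right.
have FZ e : F e -> ends e `<=` Z.
  by move=> Fe v ev; apply: ZW; right; exists v => //; exists e.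
have [c' Nc'] : exists c', (vorbit H @` [set v | Z v /\ nontrivial_stabiliser H v]
    #= `I_c')%card.
  apply/finite_setP; apply: sub_finite_set Zfin => _ [v [Zv _] <-].
  by exists v.
have cc' : (c <= c')%N.
  apply: card_II_le Cc Nc' _; apply: subset_card_le => O CO.
  have [v ntv vO] := Csub O CO; exists v => //; split=> //.
  by apply: ZC; rewrite vO.
have FRr : (eorbit H @` F #= `I_r)%card by rewrite FR.
have Ffin : finite_set (eorbit H @` F) by rewrite FR.
have Pfin : finite_set (eorbit H @` core A Z F).
  exact: (finite_core grpH depth_act depth0 depth_o depth_ends parent parent_uniq).
have [nb [NB le1 eq1]] := count_bridges stabT grpH le_trans le_total le_anti
  le_act vle_trans vle_total vle_anti vle_act A_act depth_act depth0 depth_o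
  depth_ends parent parent_uniq Zact Zfin Zo Zpar F_act Ffin FA FZ FRr Nc'.
exists Z, F, nb; split=> //; split=> //; by exists c'.
Qed.

(** * The outside of a core that carries the whole Kurosh rank *)

Section Complete.
Variable Z : set (vertex T).
Hypothesis Z_ancestral : ancestral Z.
Hypothesis Z_nontrivial : forall v, nontrivial_stabiliser H v -> Z v.
Hypothesis nA_ends : forall e, ~ A e -> ends e `<=` Z.

Let Z_trivial v : ~ Z v -> trivial H v.
Proof. by move=> nZv /Z_nontrivial. Qed.

Let Z_edge v e : ~ Z v -> ends e v -> A e.
Proof. by move=> nZv ev; apply: contrapT => /nA_ends/(_ _ ev). Qed.

(** Two such edges lie in one orbit by [parent_uniq], and the element relating them fixes [v], whose
    stabiliser is trivial. *)
Lemma down_uniq v e f u w : ~ Z v -> ends e = [set v; u] ->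
  ends f = [set v; w] -> depth v = (depth u).+1 -> depth v = (depth w).+1 ->
  e = f.
Proof.
move=> nZv vu vw du dw.
have Ae : A e by apply: Z_edge nZv _; rewrite vu; left.
have Af : A f by apply: Z_edge nZv _; rewrite vw; left.
have /(eorbit_eq grpH)[h Hh E] : eorbit H e = eorbit H f.
  exact: (parent_uniq Ae Af vu vw).
move: vw; rewrite E (ends_act h vu) => E'.
have [[vh _]|[vh uh]] := set2_eq E'.
  by rewrite (trivialP (Z_trivial nZv) Hh vh) eact1.
by move: du; rewrite -uh depth_act//; lia.
Qed.

(** A reduced path that goes up outside [Z] stays outside and keeps going up: the only way down is
    the edge it has just crossed. *)
Lemma upward_path v e w p : ~ Z v -> is_path setT v ((e, w) :: p) ->
  reduced ((e, w) :: p) -> depth w = (depth v).+1 ->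
  (depth v < depth (path_end v ((e, w) :: p)))%N.
Proof.
elim: p v e w => [|[f x] p IH] v e w nZv /= [_ vw pp].
  by move=> _ dw; rewrite path_end_cons /path_end /= dw.
move=> [ef rp] dw; have [_ wx _] := pp.
have Ae : A e by apply: Z_edge nZv _; rewrite vw; left.
have wv : ends e = [set w; v] by rewrite vw setUC.
have nZw : ~ Z w.
  move=> Zw; apply: nZv; case: Z_ancestral => _ _ Zpar.
  exact: Zpar Zw Ae wv dw.
have Af : A f by apply: Z_edge nZw _; rewrite wx; left.
have [dwx|dx] := depth_ends Af wx.
  by case: ef; exact: down_uniq nZw wv wx dw dwx.
have := IH w f x nZw pp rp dx; rewrite !path_end_cons /= dw.
exact: ltnW.
Qed.

Lemma first_down v e w p : ~ Z v -> is_path setT v ((e, w) :: p) ->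
  reduced ((e, w) :: p) -> depth (path_end v ((e, w) :: p)) = depth v ->
  depth v = (depth w).+1.
Proof.
move=> nZv pp rp dE; have [_ vw _] := pp.
have Ae : A e by apply: Z_edge nZv _; rewrite vw; left.
have [//|dw] := depth_ends Ae vw.
by have := upward_path nZv pp rp dw; rewrite dE ltnn.
Qed.

(* Outside [Z] the tree hangs down freely: the path from [w] to [wh] starts and
   ends with corresponding edges, so its second vertex is displaced less. *)
Lemma min_displaced_in h w : h \in H -> hyperbolic T h ->
  min_displaced (T := T) h w -> Z w.
Proof.
move=> Hh hyp wmin; apply: contrapT => nZw.
have nZwh : ~ Z (vact w h).
  move=> Zwh; apply: nZw; case: Z_ancestral => Zact _ _.
  by rewrite -[w](vactK w h); apply: Zact => //; exact: HV.
have [p [pp pw rp sp]] := dist_path w (vact w h).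
case: p pp pw rp sp => [|[e v] q] pp pw rp sp.
  by apply: hyp; exists w; rewrite -pw.
have [_ wv _] := pp.
have dw : depth w = (depth v).+1.
  by apply: (first_down nZw pp rp); rewrite pw depth_act.
case/lastP E : ((e, v) :: q) pp pw rp sp => [//|q' [e' w']] pp.
rewrite path_end_rcons /= => ww rp sp; subst w'.
have [v' vE] : exists v', v' = path_end w q' by eexists.
have pq' : is_path setT w q' by move: pp; rewrite -cats1 => /is_path_cat[].
have v'w : ends e' = [set v'; vact w h].
  by move: pp; rewrite -cats1 => /is_path_cat[_ [_ ? _]]; rewrite vE.
have Er : reversal w (rcons q' (e', vact w h)) = (e', v') :: reversal w q'.
  by rewrite -cats1 reversal_cat /= vE.
have dw' : depth (vact w h) = (depth v').+1.
  apply: (first_down (p := reversal w q') (e := e') nZwh).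
  - by rewrite -Er; have := is_path_rev pp; rewrite path_end_rcons.
  - by rewrite -Er; exact: reduced_rev.
  - rewrite -Er; have := path_end_rev w (rcons q' (e', vact w h)).
    by rewrite path_end_rcons /= => ->; rewrite depth_act.
have whvh := ends_act h wv.
have v'w' : ends e' = [set vact w h; v'] by rewrite v'w setUC.
have dwh : depth (vact w h) = (depth (vact v h)).+1 by rewrite !depth_act.
(* The last edge of the path and the translate of its first edge both go down from [vact w h], so
   they agree. *)
have e'h := down_uniq nZwh v'w' whvh dw' dwh; subst e'.
have v'vh : v' = vact v h by apply: (@set2_inj _ (vact w h)); rewrite -v'w' whvh.
case: q' E vE pq' pp rp sp {Er} => [|d q'] E vE pq' pp rp sp.
  case: E => _ vwh _; move: dw; rewrite vwh depth_act//; lia.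
case: E => Ed _; subst d.
(* Without its first and last edges, the path leads from [v] to [vact v h] and is too short. *)
have := wmin v; rewrite -sp; apply/negP; rewrite -ltnNge.
have [_ _ pvq'] := pq'.
have vq' : path_end v q' = vact v h by rewrite -v'vh vE.
apply: (leq_ltn_trans (dist_le pvq' vq')).
by rewrite /= size_rcons.
Qed.

(** The minimal subtree has edges only if it is a union of axes; those of its edges that lie in [A]
    have their ends in [Z] by [min_displaced_in]. *)
Lemma minimal_subtree_core e :
  eset (minimal_subtree T H) e -> core A Z (~` A) e.
Proof.
rewrite /minimal_subtree; case: pselect => [hne|hno]; last by case: pselect => [H1|H1].
move=> [h [Hh hyp] sub]; have [Ae|nAe] := pselect (A e); last by left.
by right; split=> // v /sub; exact: min_displaced_in.
Qed.

Lemma bridges_core e : bridges le H e ->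
  core A Z (~` A) e /\ bridge_in le (core A Z (~` A)) e.
Proof.
move=> [Se [vs [es [r ei emax]]]]; split; first exact: minimal_subtree_core.
exists vs, es; split=> // j; have [Sj E N] := r j; split=> //.
exact: minimal_subtree_core.
Qed.

End Complete.

End Closure.

(** * Passage to the Dicks tree and to the whole of T/H *)

Lemma card_dicks_eorbits (G : groupType) (T : gtree G) (H : {pred G})
    (le : edge T -> edge T -> Prop) : group_closed H ->
  (range (@dicks_eorbit _ T le H) #= eorbit H @` bridges le H)%card.
Proof.
move=> grpH.
have val_bridge (e : edge (dicks_tree le H)) : bridges le H (val e).
  exact: set_mem (valP e).
have orbE (e : edge (dicks_tree le H)) :
    dicks_eorbit e = [set f | eorbit H (val e) (val f)] by [].
have refl (e : edge (dicks_tree le H)) : dicks_eorbit e e.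
  by rewrite orbE; exact: eorbit_refl.
apply: (card_eq_rel (R := fun X O => exists e : edge (dicks_tree le H),
  X = dicks_eorbit e /\ O = eorbit H (val e))).
- move=> _ [e _ <-]; exists (eorbit H (val e)); last by exists e.
  by exists (val e) => //; exact: val_bridge.
- move=> _ [e be <-]; pose e' : edge (dicks_tree le H) := SigSub (mem_set be).
  by exists (dicks_eorbit e'); [exists e'|exists e'].
- by move=> X X' O _ _ [e [-> ->]] [e' [-> E]]; rewrite !orbE E.
- move=> X O O' _ _ [e [-> ->]] [e' [E ->]].
  have := refl e'; rewrite -E orbE => -[h Hh ->].
  by rewrite eorbit_act.
Qed.

(** Pulls back to [T] the maximal subtree of T/H picked by [rank], together with the depth function
    of [spanning_tree_depth]. *)
Lemma rooted_maximal_subtree (G : groupType) (T : gtree G) (H : {pred G})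
    (grpH : group_closed H) :
  exists (A : set (edge T)) (depth : vertex T -> nat) (o : vertex T),
  [/\ rank (quotient_graph T grpH) = ecard (eorbit H @` (~` A)),
      forall e h, h \in H -> A e -> A (eact e h),
      forall v h, h \in H -> depth (vact v h) = depth v,
      (forall v, depth v = 0%N -> vorbit H v = vorbit H o) /\ depth o = 0%N &
  [/\ forall e u v, A e -> ends e = [set u; v] ->
        depth u = (depth v).+1 \/ depth v = (depth u).+1,
      forall v, depth v <> 0%N -> exists e u,
        [/\ A e, ends e = [set v; u] & depth v = (depth u).+1] &
      forall e f v v' u w, A e -> A f ->
        ends e = [set v; u] -> ends f = [set v'; w] ->
        vorbit H v = vorbit H v' ->
        depth v = (depth u).+1 -> depth v' = (depth w).+1 ->
        eorbit H e = eorbit H f]].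
Proof.
have [[o _] _ _] := gtree_tree T.
have [S [Smax ->]] := rank_maximal_subtree T grpH.
have Sspan X : vset S X.
  exact: maximal_subtree_spans (quotient_joined (grpH := grpH)) _ _ Smax.
have [d [d0 dends dpar duniq]] :=
  spanning_tree_depth (vproj grpH o) Smax.1 Sspan.
exists [set e | eset S (eproj grpH e)], (d \o vproj grpH), o.
split=> /=.
- apply: ecard_eq; apply: (card_eq_rel (R := fun X O => val X = O)).
  + move=> X nX; have [e Xe] := eproj_surj X; subst X.
    by exists (eorbit H e) => //; exists e.
  + by move=> _ [e nSe <-]; exists (eproj grpH e).
  + by move=> X X' O _ _ <- /val_inj.
  + by move=> X O O' _ _ <- <-.
- move=> e h Hh; suff -> : eproj grpH (eact e h) = eproj grpH e by [].
  by apply/eproj_eq; exact: eorbit_act.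
- move=> v h Hh; congr d; apply/vproj_eq; exact: vorbit_act.
- by split=> [v /d0/vproj_eq//|]; apply/d0.
split.
- by move=> e u v Se uv; exact: dends Se (ends_eproj grpH uv).
- move=> v dv; have [|X [Y [SX XE dE]]] := dpar (vproj grpH v).
    by move=> /d0.
  have [e Xe] := eproj_surj X; subst X; have [a [b ab]] := endsP e.
  (* Name the ends of the lifted edge so that [a] lies over the orbit of [v]; a translate of the
     edge then starts at [v] itself. *)
  wlog va : a b ab / vproj grpH v = vproj grpH a.
    move: (ends_eproj grpH ab); rewrite XE => E W.
    have [[va _]|[vb _]] := set2_eq E; first exact: W ab va.
    by apply: W vb; rewrite ab setUC.
  have Yb : Y = vproj grpH b.
    by apply: (@set2_inj _ (vproj grpH v)); rewrite -XE va; exact: ends_eproj.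
  have /vproj_eq/esym/(vorbit_eq grpH)[h Hh vE] := va.
  exists (eact e h), (vact b h).
  have -> : eproj grpH (eact e h) = eproj grpH e.
    by apply/eproj_eq; exact: eorbit_act.
  split=> //; first by rewrite vE; exact: ends_act.
  have -> : vproj grpH (vact b h) = vproj grpH b.
    by apply/vproj_eq; exact: vorbit_act.
  by rewrite -Yb.
- move=> e f v v' u w Se Sf vu v'w /(vproj_eq grpH) vv' dv dv'.
  have E : ends (eproj grpH f) = [set vproj grpH v; vproj grpH w].
    by rewrite vv'; exact: ends_eproj.
  apply/(eproj_eq grpH); apply: (duniq _ _ _ _ _ Se Sf (ends_eproj grpH vu) E dv).
  by rewrite vv'.
Qed.

Theorem theorem3p8 (G : groupType) (T : gtree G)
    (stabT : trivial_edge_stabilisers T)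
    (finT : finite_set (eorbits (T := T) predT))
    (leG : rel G) (leG_order : total_order leG)
    (leG_inv : right_invariant leG)
    (leO : rel (edge (quotient_by_G T))) (leO_order : total_order leO)
    (rep : edge (quotient_by_G T) -> edge T) (repP : representatives rep)
    (H : {pred G}) (grpH : group_closed H) :
  reduced_kurosh_rank T grpH = num_dicks_eorbits (edge_le leG leO rep) H.
Proof.
have le_trans := edge_le_trans stabT leG_order leO_order repP.
have le_total := edge_le_total leG_order leO_order repP.
have le_anti := edge_le_anti stabT leG_order leO_order repP.
have le_act := @edge_le_act G T leG leO rep leG_inv.
set le := edge_le leG leO rep.
have [vle [vle_trans vle_total vle_anti vle_act]] :=
  vertex_order T grpH leG_order leG_inv.
have [A [depth [o [rankA A_act depth_act [depth0 depth_o]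
  [depth_ends parent parent_uniq]]]]] := rooted_maximal_subtree T grpH.
have ge := bridges_ge stabT grpH le_trans le_total le_anti le_act vle_trans
  vle_total vle_anti vle_act A_act depth_act depth0 depth_o depth_ends parent
  parent_uniq.
rewrite /reduced_kurosh_rank /kurosh_rank rankA /num_nontrivial_orbits.
rewrite /num_dicks_eorbits (ecard_eq (card_dicks_eorbits le grpH)).
set R := eorbit H @` (~` A).
set C := vorbit H @` [set v | nontrivial_stabiliser H v].
(* If there were only [m] orbits of bridges, a core collecting m + 2 orbits of [R] or of [C] would
   satisfy m + 2 <= nb + 1, although its [nb] orbits of bridges are among those [m]. *)
have infinite_case : infinite_set R \/ infinite_set C ->
    infinite_set (eorbit H @` bridges le H).
  move=> inf /finite_setP[m Bm].
  have [R' [r [R'R R'r [C' [c [C'C C'c rc]]]]]] : exists R' r,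
      [/\ R' `<=` R, (R' #= `I_r)%card & exists C' c,
      [/\ C' `<=` C, (C' #= `I_c)%card & (m.+2 <= r + c)%N]].
    have c0 X : (@set0 X #= `I_0)%card by rewrite II0 card_eq00.
    case: inf => /(@infinite_subset _ _ m.+2)[S SR Sm].
      exists S, m.+2; split=> //; exists set0, 0%N; split=> //.
      by rewrite addn0.
    exists set0, 0%N; split=> //; exists S, m.+2; split=> //.
  have [Z [F [nb [_ _ [_ Pfin] _ [NB [c' [_ cc'] [le1 _]]]]]]] :=
    ge R' C' r c R'R C'C R'r C'c.
  suff : (nb <= m)%N by lia.
  apply: card_II_le NB Bm _; apply: subset_card_le => _ [e [Pe be] <-].
  by exists e => //; exact: (bridge_in_minimal stabT grpH Pfin Pe be).
have [/finite_setP[r Rr]|Rinf] := pselect (finite_set R); last first.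
  rewrite (ecard_infinite Rinf) (ecard_infinite (infinite_case (or_introl Rinf))).
  by rewrite /eadd; case: ecard.
have [/finite_setP[c Cc]|Cinf] := pselect (finite_set C); last first.
  rewrite (ecard_infinite Cinf) (ecard_infinite (infinite_case (or_intror Cinf))).
  by [].
rewrite (ecardP Rr) (ecardP Cc) /=.
(* [R] and [C] are finite and are taken whole, so that [bridges_core] applies to this core. *)
have [Z [F [nb [Zanc ZC [FE Pfin] FZ [NB [c' [Nc' _] [le1 eq1]]]]]]] :=
  ge R C r c (fun _ h => h) (fun _ h => h) Rr Cc.
have Znt v : nontrivial_stabiliser H v -> Z v.
  by move=> ntv; apply: ZC; exists v.
have FA : F = ~` A.
  rewrite FE; apply/seteqP; split=> e; last by move=> nAe; rewrite /= /R; exists e.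
  move=> [f nAf /(eorbit_eq grpH)[h Hh ->]] /(A_act _ h^-1).
  by rewrite eactK => /(_ (group_closedV grpH Hh)).
have cc' : c' = c.
  apply: card_II_uniq Nc' _; suff -> : [set v | Z v /\ nontrivial_stabiliser H v] =
    [set v | nontrivial_stabiliser H v] by [].
  by apply/seteqP; split=> [v []|v ntv]; [|split=> //; exact: Znt].
have nAZ e : ~ A e -> ends e `<=` Z by move=> nAe; apply: FZ; rewrite FA.
have EB : [set e | core A Z F e /\ bridge_in le (core A Z F) e] = bridges le H.
  apply/seteqP; split=> e; first by move=> [Pe be]; exact: (bridge_in_minimal stabT grpH Pfin Pe be).
  rewrite FA.
  exact: (bridges_core grpH depth_act depth_o depth_ends parent_uniq Zanc Znt nAZ).
(* If nb > 0, then r + c = nb + 1; if nb = 0, then r + c <= 1 and its truncated predecessor is 0. *)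
rewrite EB in NB; rewrite (ecardP NB) /epred /=; congr Some; lia.
Qed.
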